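(* Let $n\ge3$. Suppose that $(\tau,H)$ is $C$-admissible, and write $m$ for the order of $\tau$. If $H$ additionally avoids the cycle type $(4,2^{\frac{n-4}{2}})$, then $Y(\zeta)=|\operatorname{Fix}_Y(\tau)|$, where $\zeta$ is a primitive $m$-th root of unity, $Y=C\backslash S_n/H$ with $\tau\cdot CgH=C\tau gH$, and $$Y(q)=\frac{1}{[n]_q}\cdot\frac{\mathcal{H}(\mathbb{C}[x]^H;q)}{\mathcal{H}(\mathbb{C}[x]^{S_n};q)}.$$
   Context: $S_n$ acts on $\{1,\dots,n\}$; $c=(1,2,\dots,n)$, $C=\langle c\rangle$, $N_{S_n}(C)$ its normalizer. $\mathbb{C}[x]=\mathbb{C}[x_1,\dots,x_n]$ graded by degree with $S_n$ permuting variables; $\mathcal{H}(W;q)=\sum_i\dim(W_i)q^i$; $[n]_q=1+q+\cdots+q^{n-1}$; $\operatorname{Fix}_Y(\tau)$ is the set of elements of $Y$ fixed by $\tau$. A subgroup $H$ avoids a cycle type $\mu$ if no element of $H$ has cycle type $\mu$ (vacuous if $\mu$ is not a partition of $n$). Definition: suppose $\tau'\in N_{S_n}(C)$ has cycle type $(m^{\frac{n-1}{m}},1)$ or $(m^{\frac{n-2}{m}},1,1)$ for some integer $m\ge2$, and let $k=\lfloor\frac{n-1}{m}\rfloor$. If $H\le S_n$ avoids $(\ell^{n/\ell})$ for every divisor $\ell>1$ of $n$, avoids $(m^k,2)$, and, if $m$ is odd, avoids $((2m)^{k/2},2)$, then $(\tau',H)$ is called $C$-admissible. *)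

(* Defs.v *)
From HB Require Import structures.
From mathcomp Require Import all_boot all_order all_algebra all_fingroup.
From mathcomp Require Import reals.
From mathcomp Require Import complex.
From mathcomp Require Import mpoly.

Set Implicit Arguments.
Unset Strict Implicit.
Unset Printing Implicit Defensive.

Import Order.TTheory GRing.Theory Num.Theory.
Local Open Scope ring_scope.

Section CycleTypes.
Context {n : nat}.
Implicit Types (s tau : 'S_n) (H : {group 'S_n}) (mu : seq nat).

(* [porbits s] contains the fixed points of [s] as singleton orbits, so the
   orbit sizes always sum to n.  In particular, if [mu] does not sum to n then
   no permutation has cycle type [mu]. *)
Definition has_cycle_type s mu : bool :=
  perm_eq [seq #|B| | B : {set 'I_n} <- enum (porbits s)] mu.

Definition avoids H mu : Prop := forall h, h \in H -> ~~ has_cycle_type h mu.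

(* The points 1, ..., n are represented by 0, ..., n-1: this is i |-> i+1
   modulo n. *)
Definition long_cycle : 'S_n := perm (@ordS_inj n).

Definition Ccyc : {group 'S_n} := <[long_cycle]>%G.

(* The exponents are truncated divisions.  For m >= 2, whenever one of them is
   not an exact quotient (m not dividing n-1, resp. n-2; or k odd in the last
   clause, given the cycle type of tau), the resulting list does not sum to n,
   so it is the cycle type of no permutation: the clause is then false for tau
   and vacuously true for "avoids", as it should be for a non-partition. *)
Definition C_admissible tau H : Prop :=
  tau \in 'N(Ccyc)%g /\
  exists m : nat,
    let k := (n.-1 %/ m)%N in
    [/\ (2 <= m)%N,
        has_cycle_type tau (nseq (n.-1 %/ m) m ++ [:: 1%N]) \/
        has_cycle_type tau (nseq (n.-2 %/ m) m ++ [:: 1%N; 1%N]),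
        forall l : nat, (1 < l)%N -> (l %| n)%N -> avoids H (nseq (n %/ l) l),
        avoids H (nseq k m ++ [:: 2%N]) &
        odd m -> avoids H (nseq (k %/ 2) (2 * m)%N ++ [:: 2%N])].

End CycleTypes.

Section DoubleCosets.
Context {n : nat}.
Implicit Types (g tau : 'S_n) (H : {group 'S_n}) (D : {set 'S_n}).
Local Open Scope group_scope.

(* The library composes permutations from left to right.  Inversion is an
   isomorphism onto S_n with the opposite product; it preserves C, H and cycle
   types, so the choice of convention is immaterial. *)
Definition dcoset H g : {set 'S_n} := Ccyc * [set g] * H.

Definition Ydc H : {set {set 'S_n}} := [set dcoset H g | g : 'S_n].

(* Defined through a representative; see [dcoset_actE]. *)
Definition dcoset_act H tau D : {set 'S_n} := dcoset H (tau * repr D).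

Definition FixY H tau : {set {set 'S_n}} :=
  [set D in Ydc H | dcoset_act H tau D == D].

Lemma mulg_dcoset H tau g : tau \in 'N(Ccyc) ->
  dcoset H (tau * g) = [set tau] * dcoset H g.
Proof.
move=> nCt; have defC : Ccyc * [set tau] = [set tau] * Ccyc.
  by apply/esym/normC; rewrite sub1set.
by rewrite /dcoset -mulg_set1 !mulgA defC.
Qed.

Lemma dcoset_actE H tau g : tau \in 'N(Ccyc) ->
  dcoset_act H tau (dcoset H g) = dcoset H (tau * g).
Proof.
move=> nCt; rewrite /dcoset_act !mulg_dcoset //; congr (_ * _).
have: repr (dcoset H g) \in dcoset H g.
  apply: (@mem_repr _ _ g); rewrite /dcoset -[g in g \in _]mulg1 mem_mulg //.
  by rewrite -[g in g \in _]mul1g mem_mulg ?set11.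
case/mulsgP=> _ h /mulsgP[c _ Cc /set1P-> ->] Hh ->.
by rewrite /dcoset -!mulg_set1 !mulgA rcoset_id // -!mulgA lcoset_id.
Qed.

End DoubleCosets.

Section InvariantForms.
Context (F : fieldType) (n d : nat).
Implicit Types (s : 'S_n.+1) (H : {group 'S_n.+1}).

Local Notation forms := (dhomog n.+1 F d).

Lemma msym_homog s (p : forms) : msym s (val p) \is d.-homog.
Proof.
have /pihomog_dE {1}<- := dhomog_is_dhomog p.
by rewrite msym_pihomog pihomogP.
Qed.

Definition msymh s (p : forms) : forms := DHomog (msym_homog s p).

Fact msymh_is_linear s : linear (msymh s).
Proof. by move=> a p q; apply/val_inj; rewrite /= msymD msymZ. Qed.

HB.instance Definition _ s :=
  GRing.isLinear.Build F forms forms *:%R (msymh s) (msymh_is_linear s).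

Definition invariant_forms H : {vspace forms} :=
  (\bigcap_(h in H) fixedSpace (linfun (msymh h)))%VS.

Lemma invariant_formsP H (p : forms) :
  reflect (forall h, h \in H -> msym h (val p) = val p)
          (p \in invariant_forms H).
Proof.
apply: (iffP idP) => [pH h Hh | pH].
  have /fixedSpaceP : p \in fixedSpace (linfun (msymh h)).
    by move: pH; rewrite !memvE => /subv_bigcapP; apply.
  by rewrite lfunE => /(congr1 val).
rewrite memvE; apply/subv_bigcapP => h Hh; rewrite -memvE.
by apply/fixedSpaceP; rewrite lfunE; apply/val_inj/pH.
Qed.

End InvariantForms.

(* Coefficient of q^d in the Hilbert series of F[x_1, ..., x_n]^H.  The library
   makes the space of forms a [vectType] only in a positive number of
   variables; in zero variables the ring is F. *)
Definition hilb (F : fieldType) (n : nat) : {group 'S_n} -> nat -> nat :=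
  match n with
  | 0 => fun _ d => (d == 0)%N
  | _.+1 => fun H d => \dim (invariant_forms F d H)
  end.

Definition qint (F : fieldType) (n : nat) : {poly F} := \poly_(i < n) 1.

(* Y(q) = 1/[n]_q * Hilb(F[x]^H) / Hilb(F[x]^(S_n)) in F[[q]], with the
   denominators (whose constant coefficients are 1) cleared: coefficient by
   coefficient, Y(q) [n]_q Hilb(F[x]^(S_n)) = Hilb(F[x]^H). *)
Definition is_Yq (F : fieldType) (n : nat) (H : {group 'S_n})
    (Yq : {poly F}) : Prop :=
  forall d : nat,
    \sum_(i < d.+1)
      (Yq * qint F n)`_i * (hilb F [set: 'S_n]%G (d - i))%:R
    = (hilb F H d)%:R.

(* Main.v *)
(* By Molien's formula, Y(q) is the average over h in H of
     Q_h(q) = (1-q) (1-q)(1-q^2)...(1-q^(n-1)) / prod_j (1 - q^(l_j)),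
   where the l_j are the cycle lengths of h.  Counting cyclotomic factors, Q_h
   is a polynomial as soon as h is not of type (l^(n/l)) with l > 1.  The
   element tau has f = 1 or 2 fixed points and k cycles of length m; at a
   primitive m-th root of unity Q_h vanishes unless h has k cycles of length
   divisible by m, which by avoidance forces the type (m^k, 1^f) of tau, and
   then Q_h(zeta) = m^k k!.

   On the other side, C acts freely on S_n/H, so n |H| |Fix_Y(tau)| counts the
   pairs (s, g) with s in C tau and g^-1 s g in H.  An s with a fixed point is
   conjugate to tau under C, and there are n/f of these; each contributes the
   number of h in H of the type of tau times the order m^k k! f! of the
   centralizer.  An s without fixed point contributes nothing: either s^m is a
   nontrivial element of C, or s has type (m^(n/m)) or (m^k, 2). *)
Require Import Defs.
From HB Require Import structures.
From mathcomp Require Import all_boot all_order all_algebra all_fingroup.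
From mathcomp Require Import all_solvable all_field zify ring.
From mathcomp Require Import reals.
From mathcomp Require Import complex.
From mathcomp Require Import mpoly.
Import GRing.Theory Num.Theory.

Set Implicit Arguments.
Unset Strict Implicit.
Unset Printing Implicit Defensive.


(** * Conjugating permutations of the same cycle type *)

Section Intertwiners.
Variable T : finType.
Implicit Types (s t g : {perm T}) (x y : T) (ds : seq nat) (U : {set T}).

Definition cycle_sizes s : seq nat :=
  [seq #|B| | B : {set T} <- enum (porbits s)].

Lemma porbit_gt0 s x : 0 < #|porbit s x|.
Proof. by rewrite lt0n card_porbit_neq0. Qed.

Lemma expg_fix s j x : ((s ^+ j)%g x == x) = (#|porbit s x| %| j).
Proof.
set p := #|porbit s x|.
have sp : (s ^+ p)%g x = x by rewrite permX iter_porbit.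
have spq q : (s ^+ (q * p))%g x = x.
  by elim: q => [|q IHq]; rewrite ?perm1 // mulSn expgD permM sp.
rewrite {1}(divn_eq j p) expgD permM spq /dvdn.
have lt_r : j %% p < p by rewrite ltn_mod porbit_gt0.
have p_gt0 : 0 < p := porbit_gt0 s x.
rewrite permX.
(* The first [p] iterates of [x] are distinct, so the remainder [j %% p] fixes [x] only when it is
   0. *)
have := nth_uniq x (i := j %% p) (j := 0) _ _ (uniq_traject_porbit s x).
by rewrite size_traject !nth_traject //= => ->.
Qed.

Lemma expg_eq_on s i j x :
  ((s ^+ i)%g x == (s ^+ j)%g x) = (i == j %[mod #|porbit s x|]).
Proof.
wlog le_ij : i j / i <= j.
  move=> H; case/orP: (leq_total i j) => /H // E.
  by rewrite eq_sym E eq_sym.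
rewrite eq_sym -{1}(subnK le_ij) addnC expgD permM expg_fix porbit_perm.
by rewrite eq_sym eqn_mod_dvd.
Qed.

Lemma sum_porbits s (F : {set T} -> nat) :
  \sum_x F (porbit s x) = \sum_(B in porbits s) #|B| * F B.
Proof.
rewrite (partition_big_imset (porbit s)) /=; apply: eq_bigr => B.
case/imsetP=> z _ ->; rewrite -sum_nat_const.
apply: eq_big => [x|x /eqP-> //]; exact: eq_porbit_mem.
Qed.

Lemma sumn_cycle_sizes s : sumn (cycle_sizes s) = #|T|.
Proof.
have := sum_porbits s (fun=> 1); rewrite sum1_card => ->.
by rewrite sumnE big_map big_enum; apply: eq_bigr => B _; rewrite muln1.
Qed.

Lemma card_porbit_eq s d :
  #|[set x | #|porbit s x| == d]| = d * count_mem d (cycle_sizes s).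
Proof.
rewrite -sum1dep_card big_mkcond /=.
rewrite (sum_porbits s (fun B => if #|B| == d then 1 else 0)).
rewrite -sum1_count big_map [in RHS]big_mkcond big_distrr big_enum /=.
by apply: eq_bigr => B _; case: eqP => [->|]; rewrite ?muln0.
Qed.

Lemma cycle_sizes_gt0 s : all (leq 1) (cycle_sizes s).
Proof.
apply/allP => _ /mapP[B + ->]; rewrite mem_enum => /imsetP[x _ ->].
exact: porbit_gt0.
Qed.

(** A multiplicity is the number of points on cycles of length [d], divided by [d]. This says
    nothing about [d = 0], whence the positivity of [ds]. *)
Lemma perm_cycle_sizesP s ds : all (leq 1) ds ->
  (forall d, #|[set x | #|porbit s x| == d]| = d * count_mem d ds) ->
  perm_eq (cycle_sizes s) ds.
Proof.
move=> ds_gt0 Hds; apply/allP => d _; apply/eqP.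
case: (posnP d) => [->|d_gt0].
  have no0 es : all (leq 1) es -> count_mem 0 es = 0.
    by move=> /allP es_gt0; apply/count_memPn/negP => /es_gt0.
  by rewrite !no0 ?cycle_sizes_gt0.
by apply/eqP; rewrite -(eqn_pmul2l d_gt0) -card_porbit_eq Hds.
Qed.

Lemma porbitJ s g x : porbit (s ^ g)%g (g x) = g @: porbit s x.
Proof.
apply/setP => y; have [z ->] : exists z, y = g z.
  by exists ((g^-1)%g y); rewrite permKV.
rewrite mem_imset; last exact: perm_inj.
apply/porbitP/porbitP => [[j] | [j ->]]; last by exists j; rewrite -conjXg permJ.
by rewrite -conjXg permJ => /perm_inj zE; exists j.
Qed.

Lemma card_porbitJ s g x : #|porbit (s ^ g)%g (g x)| = #|porbit s x|.
Proof. by rewrite porbitJ card_imset //; apply: perm_inj. Qed.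

Lemma commute_conj s t g : (s * g = g * t -> t = s ^ g)%g.
Proof. by move=> sg; rewrite conjgE sg mulKg. Qed.

Lemma cycle_sizesJ s g : perm_eq (cycle_sizes (s ^ g)%g) (cycle_sizes s).
Proof.
apply: perm_cycle_sizesP (cycle_sizes_gt0 s) _ => d.
rewrite -card_porbit_eq -[RHS](card_imset _ (@perm_inj _ g)).
apply: eq_card => y; have [z ->] : exists z, y = g z.
  by exists ((g^-1)%g y); rewrite permKV.
rewrite mem_imset; last exact: perm_inj.
by rewrite !inE card_porbitJ.
Qed.

(* A representative of each cycle of [s], in the order of the lengths [ds]. *)
Definition adapted s ds (zs : seq T) :=
  ([seq #|porbit s z| | z <- zs] == ds) && uniq [seq porbit s z | z <- zs].

Lemma adapted_exists s ds :
  perm_eq (cycle_sizes s) ds -> exists zs, adapted s ds zs.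
Proof.
rewrite perm_sym => /(perm_iotaP 0)[Is]; rewrite size_map => eqIs ->.
set Bs := [seq nth set0 (enum (porbits s)) i | i <- Is].
have eqBs : perm_eq Bs (enum (porbits s)) by apply/(perm_iotaP set0); exists Is.
have -> : [seq nth 0 (cycle_sizes s) i | i <- Is] = [seq #|B| | B : {set T} <- Bs].
  rewrite -map_comp; apply/eq_in_map => i.
  by rewrite (perm_mem eqIs) mem_iota => lt_i; rewrite (nth_map set0).
move: Bs eqBs => Bs eqBs.
have [zs eq_zs] : exists zs, map (porbit s) zs = Bs.
  have : {subset Bs <= porbits s} by move=> B; rewrite (perm_mem eqBs) mem_enum.
  elim: Bs {eqBs} => [|B Bs IHBs] sBs; first by exists [::].
  have /imsetP[z _ ->] := sBs B (mem_head _ _).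
  have [|zs <-] := IHBs; last by exists (z :: zs).
  by move=> C BsC; apply: sBs; rewrite inE BsC orbT.
exists zs; rewrite /adapted eq_zs -eq_zs -map_comp eqxx /= eq_zs.
by rewrite (perm_uniq eqBs) enum_uniq.
Qed.

Lemma adapted_cover s ds zs : perm_eq (cycle_sizes s) ds -> adapted s ds zs ->
  forall x, exists i j, i < size zs /\ x = (s ^+ j)%g (nth x zs i).
Proof.
move=> eq_ds /andP[/eqP def_ds Uzs] x.
have eq_sz : size (enum (porbits s)) <= size [seq porbit s z | z <- zs].
  move: (perm_size eq_ds); rewrite -def_ds !size_map => ->; exact: leqnn.
have [|_ E] := uniq_min_size Uzs _ eq_sz.
  by move=> _ /mapP[z _ ->]; rewrite mem_enum imset_f.
have /mapP[z zs_z] : porbit s x \in [seq porbit s z | z <- zs].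
  by rewrite E mem_enum imset_f.
move/eqP; rewrite eq_porbit_mem => /porbitP[j xE].
by exists (index z zs), j; rewrite index_mem nth_index.
Qed.

(** The graph of the conjugator to be built, following [s] and [t] in parallel from matching
    representatives. The arguments [x] and [y] double as default values of [nth]. *)
Definition matched s t xs ys x y := exists i j,
  [/\ i < size xs, x = (s ^+ j)%g (nth x xs i) & y = (t ^+ j)%g (nth y ys i)].

(** The representatives lie on distinct cycles, so [x] determines [i]. It determines [j] modulo the
    length of its cycle, which is also the length of the matching cycle of [t]. *)
Lemma matched_fun s t ds xs ys x y y' : adapted s ds xs -> adapted t ds ys ->
  matched s t xs ys x y -> matched s t xs ys x y' -> y = y'.
Proof.
case/andP=> /eqP def_ds Uxs /andP[/eqP def_ds' _].
have sz : size ys = size xs.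
  by rewrite -(size_map (fun z => #|porbit t z|)) def_ds' -def_ds size_map.
move=> [i [j [lt_i xE ->]]] [i' [j' [lt_i' xE' ->]]].
have eq_i : i = i'.
  apply/eqP; rewrite -(nth_uniq set0 _ _ Uxs) ?size_map //.
  rewrite !(nth_map x) //; apply/eqP.
  by rewrite -(porbit_perm s j) -xE {1}xE' porbit_perm.
rewrite -eq_i (set_nth_default y) ?sz //; apply/eqP; rewrite expg_eq_on.
have -> : #|porbit t (nth y ys i)| = #|porbit s (nth x xs i)|.
  rewrite -(nth_map _ 0 (fun z => #|porbit t z|)) ?sz // def_ds' -def_ds.
  by rewrite (nth_map x).
by rewrite -expg_eq_on -xE eq_i -xE'.
Qed.

(** A map between representatives extends equivariantly along the cycles because matching cycles
    have equal lengths. *)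
Lemma intertwiner_exists s t ds xs ys :
    perm_eq (cycle_sizes s) ds -> adapted s ds xs ->
    adapted t ds ys ->
  exists2 g : {perm T}, (s * g = g * t)%g & map g xs = ys.
Proof.
move=> eq_s ad_s ad_t.
have sz : size ys = size xs.
  have [/andP[/eqP + _] /andP[/eqP + _]] := (ad_s, ad_t).
  by move=> <- /(congr1 size); rewrite !size_map.
have ex_f x : exists y, matched s t xs ys x y.
  have [i [j [lt_i xE]]] := adapted_cover eq_s ad_s x.
  exists ((t ^+ j)%g (nth x ys i)), i, j; split=> //.
  by congr (_ _); apply: set_nth_default; rewrite sz.
have [f Pf] := fin_all_exists ex_f.
(* Exchanging [s] and [t] turns uniqueness of the image into injectivity. *)
have inj_f : injective f.
  move=> x x' eq_f; apply: (matched_fun ad_t ad_s (x := f x)).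
    by have [i [j [? ? ?]]] := Pf x; exists i, j; rewrite sz.
  by rewrite eq_f; have [i [j [? ? ?]]] := Pf x'; exists i, j; rewrite sz.
exists (perm inj_f).
  apply/permP => x; rewrite !permM !permE.
  apply: matched_fun ad_s ad_t (Pf _) _.
  have [i [j [lt_i xE fE]]] := Pf x; exists i, j.+1; split=> //.
    by rewrite expgSr permM {1}xE; congr (s (_ _)); apply: set_nth_default.
  rewrite expgSr permM {1}fE; congr (t (_ _)); apply: set_nth_default.
  by rewrite sz.
case: xs => [|x0 xs] in sz ad_s Pf ex_f *; first by case: ys sz {ad_t Pf ex_f}.
apply: (@eq_from_nth _ x0); rewrite size_map // => i lt_i.
rewrite (nth_map x0) // permE.
apply: matched_fun ad_s ad_t (Pf _) _; exists i, 0; split=> //.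
  by rewrite perm1; apply: set_nth_default.
by rewrite perm1; apply: set_nth_default; rewrite sz.
Qed.

(** [U] collects the points of the cycles already used, so that later representatives lie on new
    cycles. *)
Fixpoint adapted_lists t ds U : seq (seq T) :=
  if ds is d :: ds' then
    [seq y :: ys | y <- enum [set y | (y \notin U) && (#|porbit t y| == d)],
                   ys <- adapted_lists t ds' (U :|: porbit t y)]
  else [:: [::]].

Lemma mem_adapted_lists t ds U zs :
  (zs \in adapted_lists t ds U) = adapted t ds zs && all [predC U] zs.
Proof.
elim: ds U zs => [|d ds IHds] U [|z zs] //=.
  by apply/negbTE/negP => /allpairsPdep[? [? []]].
have -> : (z :: zs \in adapted_lists t (d :: ds) U) =
  [&& z \notin U, #|porbit t z| == d &
      zs \in adapted_lists t ds (U :|: porbit t z)].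
  apply/allpairsPdep/and3P => [[y [ys [+ ys_in [-> ->]]]] | [zU zd zs_in]].
    by rewrite mem_enum inE => /andP[].
  by exists z, zs; rewrite mem_enum inE zU.
rewrite IHds /adapted /= eqseq_cons.
have -> : all [predC U :|: porbit t z] zs =
    all [predC U] zs && (porbit t z \notin [seq porbit t y | y <- zs]).
  rewrite -has_pred1 has_map -all_predC -all_predI.
  apply: eq_all => y /=; rewrite inE negb_or porbit_sym -eq_porbit_mem.
  by rewrite (eq_sym (porbit t z)).
by do !case: (_ \notin _); do !case: (_ == _); do !case: (uniq _); do !case: (all _ _).
Qed.

Lemma uniq_adapted_lists t ds U : uniq (adapted_lists t ds U).
Proof.
elim: ds U => //= d ds IHds U; apply: allpairs_uniq_dep => //.
  exact: enum_uniq.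
by move=> [y ys] [y' ys'] _ _ /= [-> ->].
Qed.

(* The usual z_lambda = prod_d d^(m_d) m_d!, one part of [ds] at a time. *)
Fixpoint zcount ds :=
  if ds is d :: ds' then d * count_mem d ds * zcount ds' else 1.

(** [U] is a union of cycles of [t], and the remaining cycles have lengths [ds]. The head may be any
    remaining point on a cycle of length [d], and adding its cycle to [U] removes exactly this part
    from [ds]. *)
Lemma size_adapted_lists t ds U :
    (forall z, z \in U -> porbit t z \subset U) ->
    (forall d, #|[set z | (z \notin U) && (#|porbit t z| == d)]|
       = d * count_mem d ds) ->
  size (adapted_lists t ds U) = zcount ds.
Proof.
elim: ds U => [|d ds IHds] U sU cU //=.
rewrite size_allpairs_dep.
have E y : y \in enum [set y | (y \notin U) && (#|porbit t y| == d)] ->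
    size (adapted_lists t ds (U :|: porbit t y)) = zcount ds.
  rewrite mem_enum inE => /andP[yU /eqP yd]; apply: IHds.
    move=> z /setUP[/sU|yz]; first by move/subset_trans; apply; apply: subsetUl.
    by move: yz; rewrite -eq_porbit_mem => /eqP->; apply: subsetUr.
  move=> d'; have := cU d'; rewrite -(cardsID (porbit t y)) /= mulnDr.
  set A := [set z | _]; set A' := [set z | _].
  have -> : A :\: porbit t y = A'.
    by apply/setP=> z; rewrite !inE negb_or andbA (andbC (z \notin porbit t y)).
  suff -> : #|A :&: porbit t y| = d' * (d == d') by move/addnI.
  have [dd|d'd] := eqVneq d d'.
    rewrite muln1 -dd -yd; apply: eq_card => z; rewrite !inE; case zy: (z \in porbit t y).
      move: (zy); rewrite -eq_porbit_mem => /eqP->; rewrite yd dd eqxx !andbT.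
      by apply: contra yU => /sU/subsetP; apply; rewrite porbit_sym.
    by rewrite andbF.
  rewrite muln0; apply: eq_card0 => z; rewrite !inE; apply/negP.
  case/andP=> /andP[_ /eqP zd]; rewrite -eq_porbit_mem => /eqP zy.
  by case/eqP: d'd; rewrite -yd -zd zy.
rewrite sumnE big_map (eq_big_seq (fun=> zcount ds)) //.
by rewrite big_const_seq count_predT iter_addn_0 -cardE cU mulnC.
Qed.

(** An intertwiner is determined by its values on representatives of the cycles of [s], and these
    values may form any list adapted to [t]. *)
Lemma card_intertwiners s t ds :
    perm_eq (cycle_sizes s) ds -> perm_eq (cycle_sizes t) ds ->
  #|[set g : {perm T} | (s * g == g * t)%g]| = zcount ds.
Proof.
move=> eq_s eq_t; have [xs ad_s] := adapted_exists eq_s.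
rewrite -(@size_adapted_lists t ds set0); last 2 first.
- by move=> z; rewrite inE.
- move=> d; have /seq.permP/(_ (pred1 d)) <- := eq_t.
  by rewrite -card_porbit_eq; apply: eq_card => z; rewrite !inE.
rewrite cardE -(size_map (fun g : {perm T} => map g xs)).
apply/perm_size/uniq_perm; last 2 first.
- exact: uniq_adapted_lists.
- move=> ys; rewrite mem_adapted_lists; apply/mapP/andP.
    case=> g; rewrite mem_enum inE => /eqP sg ->.
    rewrite (commute_conj sg); split; last by apply/allP => ?; rewrite !inE.
    case/andP: ad_s => /eqP <- Uxs; rewrite /adapted -!map_comp.
    apply/andP; split; first by apply/eqP/eq_map => x /=; rewrite card_porbitJ.
    rewrite (eq_map (porbitJ s g)) (map_comp (fun B : {set T} => g @: B)).
    by rewrite (map_inj_uniq (imset_inj perm_inj)).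
  case=> ad_t _; have [g sg <-] := intertwiner_exists eq_s ad_s ad_t.
  by exists g; rewrite // mem_enum inE sg.
rewrite map_inj_in_uniq ?enum_uniq // => g g'; rewrite !mem_enum !inE.
move=> /eqP sg /eqP sg' eq_g; apply/permP => x.
have [i [j [lt_i ->]]] := adapted_cover eq_s ad_s x.
have E h y l : (s * h = h * t)%g -> h ((s ^+ l)%g y) = (t ^+ l)%g (h y).
  by move/commute_conj->; rewrite -conjXg permJ.
rewrite !E //; by congr (_ _); move/eq_in_map: eq_g; apply; apply: mem_nth.
Qed.

End Intertwiners.

Lemma zcount_nseq k d es : d \notin es ->
  zcount (nseq k d ++ es) = d ^ k * k`! * zcount es.
Proof.
move=> d_es; elim: k => [|k IHk] /=; first by rewrite !mul1n.
rewrite IHk eqxx count_cat count_nseq /= eqxx (count_memPn d_es) addn0 mul1n.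
by rewrite add1n expnS factS !mulnA; congr (_ * _ * _); rewrite mulnAC.
Qed.

(** * Fixed points of powers, and cycle types with one repeated length *)

Section FixedPoints.
Variable T : finType.
Implicit Types (s t g : {perm T}) (x y : T) (ds : seq nat) (U : {set T}).

Definition fixpts s := [set x | s x == x].

Lemma card_fixptsJ s g : #|fixpts (s ^ g)%g| = #|fixpts s|.
Proof.
rewrite -[RHS](card_imset _ (@perm_inj _ g)); apply: eq_card => y.
have [z ->] : exists z, y = g z by exists ((g^-1)%g y); rewrite permKV.
rewrite mem_imset; last exact: perm_inj.
by rewrite !inE permJ (inj_eq perm_inj).
Qed.

Lemma porbit_fixptsX s x : porbit s x \subset fixpts (s ^+ #|porbit s x|)%g.
Proof.
apply/subsetP => y; rewrite -eq_porbit_mem => /eqP yx.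
by rewrite inE expg_fix yx.
Qed.

Lemma cycle_sizes_const s l : (forall x, #|porbit s x| = l) -> 0 < l ->
  l %| #|T| /\ perm_eq (cycle_sizes s) (nseq (#|T| %/ l) l).
Proof.
move=> sl l_gt0.
have /all_pred1P E : all (pred1 l) (cycle_sizes s).
  apply/allP => _ /mapP[B + ->]; rewrite mem_enum => /imsetP[x _ ->] /=.
  by rewrite sl.
have := sumn_cycle_sizes s; rewrite E sumn_nseq => <-.
by rewrite dvdn_mulr // mulKn.
Qed.

Lemma cycle_sizes_two s m k x : 2 < m -> #|T| = m * k + 2 ->
    #|porbit s x| = 2 -> (forall y, y \notin porbit s x -> #|porbit s y| = m) ->
  perm_eq (cycle_sizes s) (nseq k m ++ [:: 2]).
Proof.
move=> m_gt2 cT sx sy; apply: perm_cycle_sizesP.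
  by rewrite all_cat all_nseq /= andbT (ltnW (ltnW m_gt2)) orbT.
have inx y : y \in porbit s x -> #|porbit s y| = 2.
  by rewrite -eq_porbit_mem => /eqP->.
move=> d; rewrite count_cat count_nseq /= addn0 mulnDr.
rewrite -(cardsID (porbit s x)) addnC; congr (_ + _).
  have [->|dm] := eqVneq d m.
    rewrite mul1n; apply/eqP; rewrite -(eqn_add2r 2) -cT -{1}sx -cardsUI.
    rewrite (_ : _ :&: _ = set0) ?cards0 ?addn0; last first.
      by apply/setP=> y; rewrite !inE; case: (y \in _); rewrite ?andbF.
    rewrite (_ : _ :|: _ = setT) ?cardsT //; apply/setP => y; rewrite !inE.
    by have [|/sy->] := boolP (y \in porbit s x); rewrite ?orbT ?eqxx.
  rewrite muln0; apply: eq_card0 => y; rewrite !inE.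
  have [|/sy->] := boolP (y \in porbit s x) => //=.
  by rewrite eq_sym (negbTE dm).
have [<-|d2] := eqVneq 2 d.
  rewrite muln1 -sx; apply: eq_card => y; rewrite !inE.
  have [/inx->|] := boolP (y \in porbit s x); rewrite ?andbF ?andbT ?sx //.
rewrite muln0; apply: eq_card0 => y; rewrite !inE.
have [/inx->|] := boolP (y \in porbit s x); rewrite ?andbF ?andbT //.
by rewrite (negbTE d2).
Qed.

Section AlmostRegular.
Variables (t : {perm T}) (m k f : nat).
Hypotheses (m_gt1 : 1 < m)
           (tT : perm_eq (cycle_sizes t) (nseq k m ++ nseq f 1)).

Lemma card_type_mk1 : #|T| = m * k + f.
Proof.
by rewrite -(sumn_cycle_sizes t) (perm_sumn tT) sumn_cat !sumn_nseq mul1n.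
Qed.

Lemma porbit_type_mk1 x : #|porbit t x| = m \/ #|porbit t x| = 1.
Proof.
have : #|porbit t x| \in cycle_sizes t.
  by apply: map_f; rewrite mem_enum imset_f.
by rewrite (perm_mem tT) mem_cat !mem_nseq => /orP[] /andP[_ /eqP]; auto.
Qed.

Lemma fixpts_type_mk1 j : ~~ (m %| j) -> #|fixpts (t ^+ j)%g| = f.
Proof.
move=> mj.
have -> : fixpts (t ^+ j)%g = [set x | #|porbit t x| == 1].
  apply/setP=> x; rewrite !inE expg_fix.
  have [->|->] := porbit_type_mk1 x; last by rewrite dvd1n.
  by rewrite (negbTE mj) gtn_eqF.
rewrite card_porbit_eq mul1n; have /seq.permP/(_ (pred1 1))-> := tT.
by rewrite count_cat !count_nseq /= gtn_eqF // mul1n.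
Qed.

Lemma expg_type_mk1 : (t ^+ m = 1)%g.
Proof.
apply/permP=> x; rewrite perm1; apply/eqP; rewrite expg_fix.
by have [->|->] := porbit_type_mk1 x; rewrite ?dvdnn ?dvd1n.
Qed.

Lemma order_type_mk1 : 0 < k -> #[t]%g = m.
Proof.
move=> k_gt0; apply/eqP; rewrite eqn_dvd order_dvdn expg_type_mk1 eqxx /=.
have : m \in cycle_sizes t.
  by rewrite (perm_mem tT) mem_cat mem_nseq k_gt0 eqxx.
case/mapP=> B; rewrite mem_enum => /imsetP[x _ ->] ->.
by rewrite -expg_fix expg_order perm1.
Qed.

Lemma zcount_type_mk1 : zcount (nseq k m ++ nseq f 1) = m ^ k * k`! * f`!.
Proof.
rewrite zcount_nseq; last by rewrite mem_nseq gtn_eqF ?andbF.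
by congr (_ * _); rewrite -[nseq f 1]cats0 zcount_nseq //= exp1n mul1n muln1.
Qed.

End AlmostRegular.
End FixedPoints.

(** * The coset of tau modulo a regular cyclic group *)

Section Regular.
Variables (T : finType) (C : {group {perm T}}).
Implicit Types (s t g : {perm T}) (x y : T).
Hypotheses (freeC : forall a x, a \in C -> a x = x -> a = 1%g)
           (transC : forall x y, exists2 a, a \in C & a x = y).
Local Open Scope group_scope.

Lemma freeC_eq a b x : a \in C -> b \in C -> a x = b x -> a = b.
Proof.
move=> Ca Cb eq_ab; apply/eqP; rewrite eq_mulgV1; apply/eqP.
apply: (@freeC _ x); first by rewrite groupM ?groupV.
by rewrite permM eq_ab permK.
Qed.

Lemma regular_card (x0 : T) : #|C| = #|T|.
Proof.
rewrite -(@card_in_imset _ _ (fun a : {perm T} => a x0) (mem C)); last first.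
  by move=> a b Ca Cb; apply: freeC_eq.
apply: eq_card => y; have [a Ca <-] := transC x0 y.
by rewrite inE imset_f.
Qed.

Lemma regular_cycle_sizes a : a \in C -> (0 < #|T|)%N ->
  #[a] %| #|T| /\ perm_eq (cycle_sizes a) (nseq (#|T| %/ #[a]) #[a]).
Proof.
move=> Ca T_gt0; apply: cycle_sizes_const => // x.
apply/eqP; rewrite eqn_dvd -expg_fix expg_order perm1 eqxx /= order_dvdn.
apply/eqP/(@freeC _ x); first exact: groupX.
by rewrite permX iter_porbit.
Qed.

(** Let [a] in [C] carry [y] to [x]. Since [t] normalizes [C], [t ^ a] lies in the coset of [t]; it
    fixes [x], and by freeness only one element of the coset does. *)
Lemma coset_fix_conj s t x y : t \in 'N(C) -> s \in C :* t -> s x = x -> t y = y ->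
  exists2 a, a \in C & s = t ^ a.
Proof.
move=> nCt /rcosetP[b Cb ->] bx ty; have [a Ca ax] := transC y x.
exists a => //.
have [d Cd dE] : exists2 d, d \in C & t ^ a = d * t.
  exists (a^-1 * a ^ t^-1); first by rewrite groupM ?groupV ?memJ_norm ?groupV.
  by rewrite !conjgE invgK !mulgA mulgKV.
rewrite dE; congr (_ * _); apply: (@freeC_eq _ _ x) => //.
apply: (@perm_inj _ t); rewrite -!permM bx -dE.
by rewrite -{2}ax permJ ty.
Qed.

Lemma rcosetX s t j : t \in 'N(C) -> s \in C :* t -> s ^+ j \in C :* (t ^+ j).
Proof.
move=> nCt sCt; elim: j => [|j IHj]; first by rewrite !expg0 mulg1 group1.
rewrite !expgS; have /rcosetP[b Cb ->] := IHj; have /rcosetP[a Ca ->] := sCt.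
apply/rcosetP; exists (a * b ^ t^-1); last by rewrite conjgE invgK !mulgA mulgKV.
by rewrite groupM // memJ_norm ?groupV.
Qed.

(** Each point [x] is fixed by exactly one element of the coset: [a * t], where [a] in [C] carries
    [x] to [t^-1 x]. *)
Lemma sum_fixpts_coset t : (\sum_(s in C :* t) #|fixpts s| = #|T|)%N.
Proof.
transitivity (\sum_(s in C :* t) \sum_x (s x == x))%N.
  by apply: eq_bigr => s _; rewrite -sum1dep_card big_mkcond.
rewrite exchange_big /= -sum1_card; apply: eq_bigr => x _.
have [a Ca aE] := transC x (t^-1 x).
rewrite (bigD1 (a * t)) /=; last by rewrite mem_rcoset mulgK.
rewrite permM aE permKV eqxx big1 // => s /andP[/rcosetP[b Cb ->] ne].
apply/eqP; rewrite eqb0; apply: contraNneq ne => bx.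
rewrite (@freeC_eq b a x) // aE; apply: (@perm_inj _ t).
by rewrite -permM bx permKV.
Qed.

(** Every element of the coset with a fixed point is conjugate to [t] and so contributes [f] to
    [sum_fixpts_coset]. *)
Lemma card_coset_fix t (f : nat) : t \in 'N(C) -> #|fixpts t| = f -> (0 < f)%N ->
  (#|[set s in C :* t | fixpts s != set0]| * f = #|T|)%N.
Proof.
move=> nCt tf f_gt0; rewrite -(sum_fixpts_coset t).
rewrite [RHS](bigID [pred s | fixpts s != set0]) /= [X in (_ + X)%N]big1; last first.
  by move=> s /andP[_]; rewrite negbK => /eqP->; rewrite cards0.
rewrite addn0 -sum_nat_const; apply: eq_big => [s|s]; first by rewrite inE.
rewrite inE => /andP[sCt /set0Pn[x]]; rewrite inE => /eqP sx.
have /set0Pn[y] : fixpts t != set0 by rewrite -card_gt0 tf.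
rewrite inE => /eqP ty; have [a _ ->] := coset_fix_conj nCt sCt sx ty.
by rewrite card_fixptsJ.
Qed.

Variable H : {group {perm T}}.
Hypothesis regH : forall (l : nat) h, (1 < l)%N -> (l %| #|T|)%N -> h \in H ->
  ~~ perm_eq (cycle_sizes h) (nseq (#|T| %/ l) l).

(** All cycles of an element of [C] have its order as length; for a nontrivial element this is a
    type that [H] avoids. Hence [C] acts freely on the cosets of [H]. *)
Lemma regular_conj_eq1 a g : (0 < #|T|)%N -> a \in C -> a ^ g \in H -> a = 1.
Proof.
move=> T_gt0 Ca agH; apply/eqP/negPn/negP => a1.
have [oa sa] := regular_cycle_sizes Ca T_gt0.
have /negP[] : ~~ perm_eq (cycle_sizes (a ^ g)) (nseq (#|T| %/ #[a]) #[a]).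
  by apply: regH; rewrite ?order_gt1.
exact: perm_trans (cycle_sizesJ _ _) sa.
Qed.

(* A point of a cycle of length l < m is fixed by s^l, which is conjugate under
   C to t^l and so has two fixed points: such a cycle has length 2 and is
   unique. *)
Lemma fixfree_avoid t (m k : nat) s g : t \in 'N(C) -> (1 < m)%N ->
    perm_eq (cycle_sizes t) (nseq k m ++ nseq 2 1%N) ->
    (forall h, h \in H -> ~~ perm_eq (cycle_sizes h) (nseq k m ++ [:: 2])) ->
    s \in C :* t -> fixpts s = set0 -> s ^ g \notin H.
Proof.
move=> nCt m_gt1 tT avH sCt s_fix; apply/negP => sgH.
have cT := card_type_mk1 tT; have T_gt0 : (0 < #|T|)%N by rewrite cT addn2.
(* [s ^+ m] lies in the coset of [t ^+ m = 1], that is in [C], and its conjugate by [g] lies in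
   [H]. *)
have sm : s ^+ m = 1.
  apply: (@regular_conj_eq1 _ g) => //; last by rewrite conjXg groupX.
  by have := rcosetX m nCt sCt; rewrite (expg_type_mk1 tT) rcoset1.
have sXfix j : ~~ (m %| j)%N -> (#|fixpts (s ^+ j)| <= 2)%N.
  move=> mj; have [->|/set0Pn[x]] := eqVneq (fixpts (s ^+ j)) set0.
    by rewrite cards0.
  rewrite inE => /eqP sx; have tf := fixpts_type_mk1 m_gt1 tT mj.
  have /set0Pn[y] : fixpts (t ^+ j) != set0 by rewrite -card_gt0 tf.
  rewrite inE => /eqP ty.
  have [a _ ->] := coset_fix_conj (groupX j nCt) (rcosetX j nCt sCt) sx ty.
  by rewrite card_fixptsJ tf.
have s_gt1 x : (1 < #|porbit s x|)%N.
  rewrite ltn_neqAle porbit_gt0 andbT eq_sym; apply/eqP => s1.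
  have : x \in fixpts s by rewrite inE -[s]expg1 expg_fix s1.
  by rewrite s_fix inE.
have s_m x : (#|porbit s x| %| m)%N by rewrite -expg_fix sm perm1.
have s2 x : #|porbit s x| != m ->
    #|porbit s x| = 2 /\ porbit s x = fixpts (s ^+ 2).
  move=> sxm; have nmx : ~~ (m %| #|porbit s x|)%N.
    by apply: contra sxm => mx; rewrite eqn_dvd s_m.
  have lex := sXfix _ nmx; have subx := porbit_fixptsX s x.
  have sx2 : #|porbit s x| = 2.
    by apply/eqP; rewrite eqn_leq s_gt1 andbT (leq_trans (subset_leq_card subx)).
  by move: subx lex; rewrite sx2 => subx lex; split=> //; apply/eqP; rewrite eqEcard subx sx2.
(* One short cycle gives the avoided type (m^k, 2), with [2 < m] because its length 2 differs from
   [m]. With no short cycle, all lengths equal [m], again an avoided type. *)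
case: (pickP (fun x => #|porbit s x| != m)) => [x sxm | all_m].
  have [sx2 xE] := s2 x sxm.
  have m_gt2 : (2 < m)%N.
    by rewrite ltn_neqAle m_gt1 -{1}sx2 sxm.
  have /negP[] := avH _ sgH; apply: perm_trans (cycle_sizesJ _ _) _.
  apply: (@cycle_sizes_two _ _ _ _ x) => // y; rewrite {1}xE => yx.
  apply/eqP/negPn/negP => sym; have [_ yE] := s2 y sym.
  by move: yx; rewrite -yE porbit_id.
have all_mE x : #|porbit s x| = m by apply/eqP; have /negbFE := all_m x.
have [mT sT] := cycle_sizes_const all_mE (ltnW m_gt1).
have /negP[] := regH m_gt1 mT sgH.
exact: perm_trans (cycle_sizesJ _ _) sT.
Qed.

End Regular.

(** * Fixed double cosets *)

Section LongCycle.
Variable n : nat.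
Local Notation C := (@Ccyc n).

Lemma long_cycleX i (x : 'I_n) : ((long_cycle ^+ i)%g x : nat) = (x + i) %% n.
Proof.
elim: i => [|i IHi]; first by rewrite perm1 addn0 modn_small.
by rewrite expgSr permM permE /= IHi addnS -addn1 modnDml addn1.
Qed.

Lemma Ccyc_free a (x : 'I_n) : a \in C -> a x = x -> a = 1%g.
Proof.
case/cycleP=> i -> /(congr1 val) /=; rewrite long_cycleX => ix.
have /eqP i0 : i == 0 %[mod n].
  by rewrite -(eqn_modDl x) ix addn0 modn_small.
by apply/permP=> y; apply/val_inj; rewrite perm1 /= long_cycleX -modnDmr i0 mod0n addn0 modn_small.
Qed.

Lemma Ccyc_trans (x y : 'I_n) : exists2 a, a \in C & a x = y.
Proof.
(* The exponent is y - x modulo [n], shifted by [n] to remain a natural number. *)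
exists (long_cycle ^+ (n - x + y))%g; first exact: mem_cycle.
apply/val_inj; rewrite /= long_cycleX addnA subnKC; last exact: ltnW.
by rewrite modnDl modn_small.
Qed.

End LongCycle.

Section DoubleCosetCount.
Variable n : nat.
Local Notation C := (@Ccyc n).
Variable H : {group 'S_n}.
Implicit Types g s t : 'S_n.
Hypothesis avoidC : forall a g, a \in C -> (a ^ g)%g \in H -> a = 1%g.
Local Open Scope group_scope.

Lemma dcosetP g g' :
  reflect (exists a h, [/\ a \in C, h \in H & g' = a * g * h]) (g' \in dcoset H g).
Proof.
apply: (iffP mulsgP) => [[_ h /mulsgP[a _ Ca /set1P-> ->] Hh ->] | [a [h [Ca Hh ->]]]].
  by exists a, h.
by exists (a * g) h; rewrite ?mem_mulg ?set11.
Qed.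

Lemma dcoset_eq g g' : (dcoset H g' == dcoset H g) = (g' \in dcoset H g).
Proof.
apply/eqP/idP => [<-|/dcosetP[a [h [Ca Hh ->]]]].
  by apply/dcosetP; exists 1, 1; rewrite !group1 mulg1 mul1g.
by rewrite /dcoset -!mulg_set1 !mulgA rcoset_id // -!mulgA lcoset_id.
Qed.

(** The map sending [(a, h)] to [a * g * h] is injective: a coincidence conjugates an element of [C]
    into [H], and [avoidC] makes it trivial. *)
Lemma card_dcoset g : (#|dcoset H g| = #|C| * #|H|)%N.
Proof.
have -> : dcoset H g = [set x.1 * g * x.2 | x in setX C H].
  apply/setP=> u; apply/dcosetP/imsetP => [[a [h [Ca Hh ->]]] | [[a h] + ->]].
    by exists (a, h); rewrite // inE Ca.
  by rewrite inE => /andP[Ca Hh]; exists a, h.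
rewrite card_in_imset ?cardsX // => -[a h] [b k]; rewrite !inE /=.
case/andP=> Ca Hh /andP[Cb Hk] E.
have Eab : (b^-1 * a) ^ g = k * h^-1.
  rewrite conjgE; apply: (canRL (mulgK h)).
  by rewrite -!mulgA (mulgA a) E !mulgA mulgKV mulVg mul1g.
have ab : a = b.
  by apply/eqP; rewrite eq_sym eq_mulVg1; apply/eqP/(avoidC (g := g)); rewrite ?Eab ?groupM ?groupV.
by rewrite ab in E *; move/mulgI: E => ->.
Qed.

(** The equation [t * g = a * g * h] says that [(a^-1 * t) ^ g = h], so [t] fixes the double coset
    exactly when some [s] in the coset has [s ^ g] in [H]. By [avoidC] there is at most one such
    [s]. *)
Lemma card_conj_mem t g : t \in 'N(C) ->
  #|[set s in C :* t | s ^ g \in H]| = (dcoset H (t * g) == dcoset H g).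
Proof.
move=> nCt; rewrite dcoset_eq; case: (dcosetP g (t * g)) => [[a [h [Ca Hh E]]]|noD].
  suff -> : [set s in C :* t | s ^ g \in H] = [set a^-1 * t] by rewrite cards1.
  apply/setP=> s; rewrite !inE; apply/andP/eqP => [[/rcosetP[b Cb ->] bH]|->].
    congr (_ * _); apply/eqP; rewrite eq_mulgV1 invgK; apply/eqP/(avoidC (g := g)).
      exact: groupM.
    suff -> : (b * a) ^ g = (b * t) ^ g * h^-1 by rewrite groupM ?groupV.
    rewrite !conjgE; apply: (canRL (mulgK h)).
    by rewrite -!mulgA (mulgA a) -E.
  rewrite mem_rcoset mulgK groupV; split=> //.
  by rewrite conjgE -!mulgA E -!mulgA mulKg mulKg.
apply: eq_card0 => s; rewrite !inE; apply/negP => /andP[/rcosetP[b Cb ->] bH].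
case: noD; exists b^-1, ((b * t) ^ g); rewrite groupV; split=> //.
by rewrite conjgE !mulgA mulgK mulVg mul1g.
Qed.

(** Double counting of the pairs [(s, g)] with [s ^ g] in [H]: each of the [#|C| * #|H|] elements
    [g] of a fixed double coset has one partner [s], and the other [g] have none. *)
Lemma card_FixY t : t \in 'N(C) ->
  (#|FixY H t| * (#|C| * #|H|) = \sum_(s in C :* t) #|[set g | (s ^ g)%g \in H]|)%N.
Proof.
move=> nCt; transitivity (\sum_(g : 'S_n) (dcoset H (t * g) == dcoset H g : nat))%N.
  rewrite (partition_big_imset (dcoset H)) /= -/(Ydc H) -sum_nat_const.
  rewrite /FixY big_set /= [LHS]big_mkcondr; apply: eq_bigr => D /imsetP[g0 _ ->].
  under [RHS]eq_bigr => g /eqP gD do rewrite -(dcoset_actE _ _ nCt) gD.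
  rewrite sum_nat_const; case: eqP; rewrite ?muln0 // muln1 => _.
  by rewrite -(card_dcoset g0); apply: eq_card => g; rewrite -dcoset_eq.
rewrite (eq_bigr _ (fun g _ => esym (card_conj_mem g nCt))).
transitivity (\sum_(g : 'S_n) \sum_(s in (C :* t)%g) ((s ^ g)%g \in H : nat))%N.
  apply: eq_bigr => g _; rewrite -sum1dep_card big_mkcondr; apply: eq_bigr => s _.
  by case: (_ \in H).
rewrite exchange_big; apply: eq_bigr => s _; rewrite -sum1dep_card [RHS]big_mkcond.
by apply: eq_bigr => g _; case: (_ \in H).
Qed.

(** The elements [g] are sorted by [h = s ^ g]; for fixed [h] they are the intertwiners of [s] and
    [h]. *)
Lemma card_conj_in s ds : perm_eq (cycle_sizes s) ds ->
  (#|[set g | (s ^ g)%g \in H]| =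
     #|[set h in H | perm_eq (cycle_sizes h) ds]| * zcount ds)%N.
Proof.
move=> s_ds; rewrite -sum_nat_const.
rewrite -sum1_card (partition_big (fun g => s ^ g) (mem H)) /=; last by move=> g; rewrite inE.
rewrite [RHS]big_set /= [RHS]big_mkcondr; apply: eq_bigr => h Hh.
have E : (\sum_(g in [set g | (s ^ g)%g \in H] | (s ^ g)%g == h) 1 =
    #|[set g | (s * g == g * h)%g]|)%N.
  rewrite -sum1dep_card; apply: eq_bigl => g; rewrite inE.
  rewrite [s * g]conjgC (inj_eq (mulgI g)) andbC.
  by case: eqP => [->|//]; rewrite [LHS]Hh.
rewrite E; case: ifP => h_ds; first exact: card_intertwiners.
apply: eq_card0 => g; rewrite !inE; apply/negP => /eqP /commute_conj hE.
case/negP: (negbT h_ds); rewrite hE; exact: perm_trans (cycle_sizesJ _ _) s_ds.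
Qed.

End DoubleCosetCount.

Section FixedDoubleCosets.
Variables (n m k f : nat) (t : 'S_n) (H : {group 'S_n}).
Local Notation C := (@Ccyc n).
Hypotheses (nCt : t \in 'N(C)%g) (m_gt1 : 1 < m) (f12 : 0 < f <= 2)
  (tT : perm_eq (cycle_sizes t) (nseq k m ++ nseq f 1))
  (regH : forall l h, 1 < l -> l %| n -> h \in H ->
     ~~ perm_eq (cycle_sizes h) (nseq (n %/ l) l))
  (avH : forall h, h \in H -> ~~ perm_eq (cycle_sizes h) (nseq k m ++ [:: 2])).

Lemma card_FixY_type :
  #|FixY H t| * #|H| =
    #|[set h in H | perm_eq (cycle_sizes h) (nseq k m ++ nseq f 1)]| * (m ^ k * k`!).
Proof.
set A := #|[set h in H | _]|.
have nE : n = m * k + f by rewrite -(card_type_mk1 tT) card_ord.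
have n_gt0 : 0 < n by case/andP: f12 => f0 _; rewrite nE addn_gt0 f0 orbT.
have T_gt0 : 0 < #|'I_n| by rewrite card_ord.
have cC : #|C| = n.
  by rewrite (regular_card (@Ccyc_free n) (@Ccyc_trans n) (Ordinal n_gt0)) card_ord.
have regH' : forall l h, 1 < l -> l %| #|'I_n| -> h \in H ->
    ~~ perm_eq (cycle_sizes h) (nseq (#|'I_n| %/ l) l).
  by rewrite card_ord.
have avC a g : a \in C -> (a ^ g)%g \in H -> a = 1%g.
  exact: (regular_conj_eq1 (@Ccyc_free n) regH' T_gt0).
have tf : #|fixpts t| = f.
  have := fixpts_type_mk1 m_gt1 tT (j := 1); rewrite expg1 dvdn1 gtn_eqF //.
  by apply.
have /andP[f_gt0 le_f2] := f12.
have cF := card_coset_fix (@Ccyc_free n) (@Ccyc_trans n) nCt tf f_gt0.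
rewrite card_ord in cF.
(* As [f] is 1 or 2, the factor [f!] of the centralizer order cancels against the n / f elements of
   the coset that have fixed points. *)
have fact_f : f`! = f by case: (f) f12 => [|[|[|]]].
have free_s s : s \in (C :* t)%g -> fixpts s = set0 ->
    #|[set g | (s ^ g)%g \in H]| = 0.
  move=> sCt s_fix; apply: eq_card0 => g; rewrite !inE; apply/negbTE.
  have [f2|f1] : f = 2 \/ f = 1 by case: (f) f12 => [|[|[|]]]; auto.
    have tT2 := tT; rewrite f2 in tT2.
    exact: (fixfree_avoid (@Ccyc_free n) (@Ccyc_trans n) regH' g nCt m_gt1 tT2 avH sCt s_fix).
  (* For [f = 1] there are [n] elements with a fixed point, which is the whole coset, so [s] cannot
     be free of fixed points. *)
  have : s \in [set s in (C :* t)%g | fixpts s != set0].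
    suff /eqP-> : [set s in (C :* t)%g | fixpts s != set0] == (C :* t)%g by [].
    rewrite eqEcard card_rcoset cC; apply/andP; split.
      by apply/subsetP=> u; rewrite inE => /andP[].
    by move: cF; rewrite f1 muln1 => ->.
  by rewrite inE s_fix eqxx andbF.
have key := card_FixY avC nCt; rewrite cC in key.
apply/eqP; rewrite -(eqn_pmul2r n_gt0) -mulnA (mulnC #|H|) key.
rewrite (bigID (fun s => fixpts s != set0)) /= [X in _ + X]big1; last first.
  by move=> s /andP[sCt]; rewrite negbK => /eqP; apply: free_s.
rewrite addn0 (eq_bigr (fun=> A * (m ^ k * k`! * f))); last first.
  move=> s /andP[sCt /set0Pn[x]]; rewrite inE => /eqP sx.
  have /set0Pn[y] : fixpts t != set0 by rewrite -card_gt0 tf.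
  rewrite inE => /eqP ty.
  have [a _ ->] := coset_fix_conj (@Ccyc_free n) (@Ccyc_trans n) nCt sCt sx ty.
  have tT' := perm_trans (cycle_sizesJ t a) tT.
  by rewrite (card_conj_in _ tT') (zcount_type_mk1 _ _ m_gt1) fact_f.
rewrite sum_nat_const -[X in X * _](_ : #|[set s in (C :* t)%g | fixpts s != set0]| = _).
  by rewrite (mulnA A) mulnCA cF.
by apply: eq_card => s; rewrite inE.
Qed.

End FixedDoubleCosets.

(** * Cycle types determined by the number of parts divisible by m *)

Lemma count_dvdn_sumn d L : all (leq 1) L ->
  d * count (dvdn d) L <= sumn L ?= iff (L == nseq (size L) d).
Proof.
elim: L => [|x L IHL] /=; first by rewrite muln0; split.
case/andP=> x_gt0 /IHL{}IHL; rewrite mulnDr eqseq_cons.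
(* A part divisible by [d] is at least [d] and any other part is positive, so the bound and its
   equality case are checked part by part. *)
apply: leqif_add IHL; case dx: (d %| x); last first.
  rewrite muln0; split=> //; rewrite ltn_eqF //.
  by apply/esym/eqP => xd; rewrite xd dvdnn in dx.
by rewrite muln1 eq_sym; apply: leqif_eq; apply: dvdn_leq.
Qed.

Lemma perm_four_twos L : all (leq 1) L -> all (dvdn 2) L ->
  sumn L = 2 * (size L).+1 -> perm_eq L (4 :: nseq (size L).-1 2).
Proof.
elim: L => [|x L IHL] //= /andP[x_gt0 L_gt0] /andP[/dvdnP[y xE] L2] sL.
have := count_dvdn_sumn 2 L_gt0; move: (L2); rewrite all_count => /eqP-> [le_sL eq_sL].
have [x2|x2] := eqVneq x 2.
  have {IHL} := IHL L_gt0 L2; rewrite x2 in sL * => IHL.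
  have {IHL} : perm_eq L (4 :: nseq (size L).-1 2) by apply: IHL; lia.
  case: L {L_gt0 L2 eq_sL} le_sL sL => [|z L] /= le_sL sL; first by lia.
  move=> pL; apply: (@perm_trans _ (2 :: 4 :: nseq (size L) 2)).
    by rewrite perm_cons.
  by apply/seq.permP => a /=; lia.
have x4 : x = 4 by lia.
by rewrite x4 perm_cons; have /eqP <- : L == nseq (size L) 2 by rewrite -eq_sL; lia.
Qed.

(** The [k] parts divisible by [m] sum to some m e with k <= e and m e <= m k + f. If e = k, they
    all equal [m], and the rest sums to [f]: it consists of ones, or is the excluded single 2. If e
    > k, then m <= f forces m = f = 2 and e = k + 1; all parts are then even and the type is the
    excluded (4, 2^(k-1)). *)
Lemma perm_type_mk1 m k f L : 1 < m -> 0 < k -> 0 < f <= 2 -> all (leq 1) L ->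
    sumn L = m * k + f -> count (dvdn m) L = k ->
    ~~ perm_eq L (nseq k m ++ [:: 2]) ->
    ~~ perm_eq L (4 :: nseq ((m * k + f - 4) %/ 2) 2) ->
  perm_eq L (nseq k m ++ nseq f 1).
Proof.
move=> m_gt1 k_gt0 f12 L_gt0 sL cL no2 no42.
pose A := filter (dvdn m) L; pose B := filter (predC (dvdn m)) L.
have pL : perm_eq L (A ++ B) by rewrite perm_sym; apply/permPl/perm_filterC.
have A_gt0 : all (leq 1) A by apply/allP=> x; rewrite mem_filter => /andP[_ /(allP L_gt0)].
have B_gt0 : all (leq 1) B by apply/allP=> x; rewrite mem_filter => /andP[_ /(allP L_gt0)].
have mA : all (dvdn m) A := filter_all _ _.
have mB : all (predC (dvdn m)) B := filter_all _ _.
have sAB : sumn A + sumn B = m * k + f by rewrite -sL (perm_sumn pL) sumn_cat.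
have szA : size A = k by rewrite size_filter.
have := count_dvdn_sumn m A_gt0; move: (mA); rewrite all_count => /eqP->; rewrite szA => -[leA eqA].
have [e eE] : exists e, sumn A = m * e.
  have /dvdnP[e ->] : m %| sumn A; last by exists e; rewrite mulnC.
  by elim: (A) mA => //= x s IHs /andP[mx /IHs]; apply: dvdn_add.
have [sA|sA] := eqVneq (m * k) (sumn A).
  have EA : A = nseq k m by apply/eqP; rewrite -eqA sA eqxx.
  move: pL no2; rewrite EA => pL no2; apply: (perm_trans pL).
  rewrite perm_cat2l; have sB : sumn B = f by lia.
  case: (B) B_gt0 sB mB pL => [|x [|y [|w s]]] /=; rewrite ?addn0; [lia| | |lia].
    move=> x_gt0 xf mx pL; have [f1|f2] : f = 1 \/ f = 2 by lia.
      by rewrite xf f1.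
    by rewrite xf f2 in pL; rewrite pL in no2.
  by move=> xy_gt0 xyf _ _; have [-> [-> ->]] : f = 2 /\ x = 1 /\ y = 1 by lia.
have e_gt : k < e by rewrite -(ltn_pmul2l (ltnW m_gt1)) -eE ltn_neqAle sA.
have [m2 [f2 eS]] : m = 2 /\ f = 2 /\ e = k.+1 by nia.
have B0 : B = [::] by case: (B) B_gt0 sAB => //= x s; lia.
case/negP: no42; rewrite B0 cats0 in pL; apply: (perm_trans pL).
subst m; apply: perm_trans (perm_four_twos A_gt0 mA _) _; first by rewrite eE eS szA.
rewrite szA; have -> : (2 * k + f - 4) %/ 2 = k.-1 by lia.
exact: perm_refl.
Qed.

(** * Exponent vectors *)

Section Exponents.
Variables n N : nat.
Local Notation expo := {ffun 'I_n -> 'I_N.+1}.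
Implicit Types (a b : expo) (s h : 'S_n).

(** The inverse makes this a right action and matches the effect of [msym] on monomials. *)
Definition expo_act a s : expo := [ffun i => a ((s^-1)%g i)].

Fact expo_act1 a : expo_act a 1 = a.
Proof. by apply/ffunP=> i; rewrite ffunE invg1 perm1. Qed.

Fact expo_actM a s t : expo_act a (s * t) = expo_act (expo_act a s) t.
Proof. by apply/ffunP=> i; rewrite !ffunE invMg permM. Qed.

Definition expo_action := TotalAction expo_act1 expo_actM.

Definition expos d : {set expo} := [set a : expo | \sum_i (a i : nat) == d].

Lemma expos_act d a s : (expo_act a s \in expos d) = (a \in expos d).
Proof.
rewrite !inE (reindex_inj (@perm_inj _ s)) /=; congr (_ == _).
by apply: eq_bigr => i _; rewrite ffunE permK.
Qed.

Lemma acts_expos (H : {set 'S_n}) d : [acts H, on expos d | expo_action].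
Proof. by apply/actsP => s _ a; rewrite expos_act. Qed.

Definition mon a : 'X_{1..n} := [multinom (a i : nat) | i < n].

Lemma mon_inj : injective mon.
Proof.
by move=> a b /mnmP E; apply/ffunP=> i; apply/val_inj; have := E i; rewrite !mnmE.
Qed.

Lemma mon_act a s : mon (expo_act a s) = [multinom mon a ((s^-1)%g i) | i < n].
Proof. by apply/mnmP => i; rewrite !mnmE ffunE. Qed.

Lemma mdeg_mon a : mdeg (mon a) = \sum_i (a i : nat).
Proof. by rewrite mdegE; apply: eq_bigr => i _; rewrite mnmE. Qed.

(** No exponent exceeds the degree, so the finite type of vectors bounded by [N] contains all
    monomials of degree [d <= N]. *)
Lemma monP d (m : 'X_{1..n}) : d <= N -> mdeg m = d -> exists2 a, a \in expos d & m = mon a.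
Proof.
move=> dN md; have le_mN i : m i < N.+1.
  by rewrite ltnS (leq_trans _ dN) // -md mdegE (bigD1 i) //= leq_addr.
have mE : m = mon [ffun i => Ordinal (le_mN i)] by apply/mnmP=> i; rewrite mnmE ffunE.
by exists [ffun i => Ordinal (le_mN i)]; rewrite // inE -mdeg_mon -mE md.
Qed.

End Exponents.

Local Open Scope ring_scope.

(** * Quotients of products of 1 - X^i *)

Lemma count_dvdn_iota d n : (0 < d)%N -> count (dvdn d) (iota 1 n) = (n %/ d)%N.
Proof.
move=> d_gt0; elim: n => [|n IHn]; first by rewrite div0n.
by rewrite -{1}(addn1 n) iotaD count_cat IHn /= addn0 add1n divnS // addnC.
Qed.

Section ProductsOneSubXn.
Variable F : fieldType.
Implicit Types (p q : {poly F}) (z : F) (L M : seq nat).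

(** The integral cyclotomic polynomial mapped to [F], which makes sense even if [F] has no primitive
    d-th root of unity. *)
Definition PhiF d : {poly F} := map_poly intr 'Phi_d.

(** The bound [b] gives all factors of a product the same index range, so that exponents can be
    added. *)
Lemma Xn_sub_1_PhiF n b : (0 < n <= b)%N ->
  'X^n - 1 = \prod_(1 <= d < b.+1) PhiF d ^+ (d %| n)%N.
Proof.
case/andP=> n_gt0 le_nb; have := prod_Cyclotomic n_gt0.
move/(congr1 (map_poly (intr : int -> F))).
rewrite rmorph_prod rmorphB /= map_polyXn rmorph1 => <-.
rewrite [RHS](eq_bigr (fun d => if (d %| n)%N then PhiF d else 1)); last first.
  by move=> d _; case: (d %| n)%N.
rewrite -big_mkcond -[RHS]big_filter; apply/perm_big/uniq_perm.
- exact: divisors_uniq.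
- by apply: filter_uniq; apply: iota_uniq.
move=> d; rewrite mem_filter mem_index_iota -dvdn_divisors //.
case dn: (d %| n)%N => //=.
by rewrite (dvdn_gt0 n_gt0 dn) ltnS (leq_trans (dvdn_leq n_gt0 dn) le_nb).
Qed.

Lemma prod_Xn_sub_1 L b : all (fun n => 0 < n <= b)%N L ->
  \prod_(n <- L) ('X^n - 1) = \prod_(1 <= d < b.+1) PhiF d ^+ count (dvdn d) L.
Proof.
move=> /allP Lb; rewrite (eq_big_seq _ (fun n nL => Xn_sub_1_PhiF (Lb n nL))).
rewrite exchange_big; apply: eq_bigr => d _ /=.
by rewrite prodrXr -sum1_count [in RHS]big_mkcond.
Qed.

(** As a root of X^m - 1, [z] is a root of some Phi_d with d dividing m; then z^d = 1, and
    primitivity gives d = m. *)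
Lemma root_PhiF m z : m.-primitive_root z -> root (PhiF m) z.
Proof.
move=> zm; have m_gt0 := prim_order_gt0 zm.
have : root (\prod_(1 <= d < m.+1) PhiF d ^+ (d %| m)%N) z.
  by rewrite -(@Xn_sub_1_PhiF m m) ?m_gt0 ?leqnn // rootE !hornerE (prim_expr_order zm) subrr.
rewrite rootE horner_prod prodf_seq_eq0 => /hasP[d].
rewrite mem_index_iota => /andP[d_gt0 d_m] /=; rewrite horner_exp.
case dm: (d %| m)%N; rewrite ?expr0 ?oner_eq0 // expr1 => zd.
suff -> : m = d by [].
apply/eqP; rewrite eqn_dvd dm andbT (prim_order_dvd zm) -subr_eq0.
have := @Xn_sub_1_PhiF d d; rewrite d_gt0 leqnn => /(_ isT)/(congr1 (horner^~ z)).
rewrite /= !hornerE => ->; rewrite horner_prod (big_rem d) /=; last first.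
  by rewrite mem_index_iota d_gt0 /=.
by rewrite dvdnn expr1 (eqP zd) mul0r.
Qed.

Lemma prod_1_sub_Xn L :
  \prod_(n <- L) (1 - 'X^n) = (-1) ^+ size L * \prod_(n <- L) ('X^n - 1) :> {poly F}.
Proof.
elim: L => [|n L IHL]; first by rewrite !big_nil mulr1.
by rewrite !big_cons IHL exprS -(opprB 'X^n) mulN1r !mulNr mulrCA.
Qed.

(** Phi_d occurs in each product as often as [d] divides an entry. The quotient is, up to sign, the
    product of the Phi_d raised to the excess, and a positive excess at [m] makes [z] a root. *)
Lemma dvdp_prod_1_sub_Xn L M : all (leq 1) L -> all (leq 1) M ->
    (forall d, 0 < d -> count (dvdn d) L <= count (dvdn d) M)%N ->
  exists Q : {poly F},
    Q * \prod_(n <- L) (1 - 'X^n) = \prod_(n <- M) (1 - 'X^n) /\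
    (forall m z, m.-primitive_root z ->
       (count (dvdn m) L < count (dvdn m) M)%N -> root Q z).
Proof.
move=> L_gt0 M_gt0 leLM; pose b := (sumn L + sumn M)%N.
have le_sumn s n : n \in s -> (n <= sumn s)%N.
  elim: s => //= k s IHs; rewrite inE => /predU1P[->|/IHs le_ns].
    exact: leq_addr.
  exact: leq_trans le_ns (leq_addl _ _).
have bL : all (fun n => 0 < n <= b)%N L.
  apply/allP => n nL; rewrite (allP L_gt0 _ nL) /=.
  exact: leq_trans (le_sumn _ _ nL) (leq_addr _ _).
have bM : all (fun n => 0 < n <= b)%N M.
  apply/allP => n nM; rewrite (allP M_gt0 _ nM) /=.
  exact: leq_trans (le_sumn _ _ nM) (leq_addl _ _).
pose E d := (count (dvdn d) M - count (dvdn d) L)%N.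
exists ((-1) ^+ size M * (-1) ^+ size L * \prod_(1 <= d < b.+1) PhiF d ^+ E d).
split.
  rewrite !prod_1_sub_Xn (prod_Xn_sub_1 bL) (prod_Xn_sub_1 bM).
  rewrite mulrACA -(mulrA _ _ ((-1) ^+ size L)) -expr2 sqrr_sign mulr1 -big_split.
  congr (_ * _); rewrite !big_nat; apply: eq_bigr => d /andP[d_gt0 _].
  by rewrite /= -exprD subnK ?leLM.
move=> m z zm lt_m; rewrite rootE hornerM horner_prod.
have m_gt0 := prim_order_gt0 zm.
have /hasP[n nM mn] : has (dvdn m) M by rewrite has_count (leq_ltn_trans _ lt_m).
have /andP[n_gt0 le_nb] := allP bM _ nM.
have le_mb : (m <= b)%N := leq_trans (dvdn_leq n_gt0 mn) le_nb.
rewrite (big_rem m) /= ?mem_index_iota ?m_gt0 // horner_exp.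
have [e ->] : exists e, E m = e.+1 by exists (E m).-1; rewrite prednK // subn_gt0.
by rewrite (eqP (root_PhiF zm)) expr0n !(mul0r, mulr0).
Qed.

(** Two expressions of (X^m - 1) / (X - 1) are compared at 1: the product of the X - z^r with 0 < r
    < m, and 1 + X + ... + X^(m-1). *)
Lemma prod_1_sub_prim m z : m.-primitive_root z ->
  \prod_(1 <= r < m) (1 - z ^+ r) = m%:R.
Proof.
move=> zm; have m_gt0 := prim_order_gt0 zm.
have := factor_Xn_sub_1 zm; rewrite big_ltn // expr0 subrX1.
move/(mulfI (negbT (polyXsubC_eq0 1)))/(congr1 (horner^~ 1)).
rewrite /= horner_prod horner_sum; under eq_bigr do rewrite hornerXsubC.
by move=> ->; under eq_bigr do rewrite hornerXn expr1n; rewrite sumr_const card_ord.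
Qed.

(** Each block of [m] consecutive indices ends at a multiple m j. Its last factor is 1 - X^m times a
    geometric sum with value j at [z], and its other factors have product [m] at [z]. *)
Lemma prod_1_sub_Xn_iota m k z : (1 < m)%N -> m.-primitive_root z ->
  exists A : {poly F},
    \prod_(i <- iota 1 (m * k)) (1 - 'X^i) = (1 - 'X^m) ^+ k * A /\
    A.[z] = (m ^ k * k`!)%:R.
Proof.
move=> m_gt1 zm; elim: k => [|k [A [IHk Az]]].
  by exists 1; rewrite muln0 big_nil mulr1 hornerC.
pose B : {poly F} := \sum_(i < k.+1) 'X^(m * i).
pose G : {poly F} := \prod_(1 <= r < m) (1 - 'X^(m * k + r)).
exists (A * B * G); split.
  have EB : 1 - 'X^(m * k + m) = (1 - 'X^m) * B.
    rewrite addnC -mulnS -opprB exprM subrX1 -mulNr opprB; congr (_ * _).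
    by apply: eq_bigr => i _; rewrite exprM.
  rewrite mulnS addnC iotaD big_cat /= IHk addnC iotaDl big_map.
  have -> : iota 1 m = index_iota 1 m.+1 by rewrite /index_iota subn1.
  rewrite big_nat_recr ?(ltnW m_gt1) //= -/G EB exprSr.
  by rewrite [G * _]mulrC -!mulrA; congr (_ * _); rewrite mulrCA.
rewrite !hornerM Az.
have -> : B.[z] = k.+1%:R.
  rewrite horner_sum (eq_bigr (fun=> 1)) ?sumr_const ?card_ord // => i _.
  by rewrite hornerXn exprM (prim_expr_order zm) expr1n.
have -> : G.[z] = m%:R.
  rewrite -(prod_1_sub_prim zm) horner_prod; apply: eq_bigr => r _.
  by rewrite !hornerE exprD exprM (prim_expr_order zm) expr1n mul1r.
rewrite -!natrM expnS factS; congr _%:R.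
by rewrite [RHS]mulnACA [RHS]mulnC (mulnC m) mulnA.
Qed.

End ProductsOneSubXn.

(** * The Molien summands Q_h and their values at roots of unity *)

Section Quotient.
Variable F : fieldType.
Implicit Types (z : F) (Q : {poly F}).

(** For d > 1 the numerator contains Phi_d to the power [n.-1 %/ d]. More than that many parts
    divisible by [d] would sum to at least [n], hence exactly [n], and would all equal [d] and
    exhaust [L]: an excluded type. *)
Lemma quotient_exists L n : all (leq 1) L -> sumn L = n -> (0 < n)%N ->
    (forall l, (1 < l)%N -> (l %| n)%N -> ~~ perm_eq L (nseq (n %/ l) l)) ->
  exists Q, Q * \prod_(i <- L) (1 - 'X^i) = \prod_(i <- 1%N :: iota 1 n.-1) (1 - 'X^i) /\
    (forall m z, (1 < m)%N -> m.-primitive_root z ->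
       count (dvdn m) L != (n.-1 %/ m)%N -> Q.[z] = 0).
Proof.
move=> L_gt0 sL n_gt0 noL.
have cM d : (1 < d)%N -> count (dvdn d) (1%N :: iota 1 n.-1) = (n.-1 %/ d)%N.
  by move=> d_gt1; rewrite /= count_dvdn_iota ?(ltnW d_gt1) // dvdn1 gtn_eqF.
have leLM d : (0 < d)%N -> (count (dvdn d) L <= count (dvdn d) (1%N :: iota 1 n.-1))%N.
  move=> d_gt0; have [le_s eq_s] := count_dvdn_sumn d L_gt0.
  have [d1|d_gt1] := leqP d 1%N.
    have -> : d = 1%N by apply/eqP; rewrite eqn_leq d1.
    rewrite !(eq_count (dvd1n : dvdn 1 =1 predT)) !count_predT /= size_iota prednK //.
    have [] := count_dvdn_sumn 1 L_gt0.
    by rewrite sL mul1n (eq_count (dvd1n : dvdn 1 =1 predT)) count_predT.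
  rewrite cM // leqNgt; apply/negP => lt_c.
  have sE : (d * count (dvdn d) L)%N = n.
    by apply/eqP; rewrite eqn_leq -{1}sL le_s /= -{1}(prednK n_gt0) mulnC -ltn_divLR.
  have dn : (d %| n)%N by rewrite -sE dvdn_mulr.
  have /eqP LE : L == nseq (size L) d by rewrite -eq_s sE sL.
  have /negP[] := noL d d_gt1 dn.
  have cE : count (dvdn d) L = size L.
    by rewrite LE count_nseq /= dvdnn mul1n size_nseq.
  by rewrite -sE mulKn // cE -LE.
have [|Q [EQ rQ]] := @dvdp_prod_1_sub_Xn F L (1%N :: iota 1 n.-1) L_gt0 _ leLM.
  by apply/allP => i; rewrite inE mem_iota => /predU1P[->|/andP[]].
exists Q; split=> // m z m_gt1 zm cm; apply/eqP/(rQ m) => //.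
by rewrite ltn_neqAle leLM ?(ltnW m_gt1) // andbT cM.
Qed.

(** The factor (1 - X^m)^k vanishes at [z] and is cancelled before evaluation. For f = 2 the last
    numerator factor 1 - X^(m k + 1) takes the value 1 - z, which cancels as well. *)
Lemma quotient_eval L n m k f z Q : (1 < m)%N -> (0 < f <= 2)%N -> n = (m * k + f)%N ->
    perm_eq L (nseq k m ++ nseq f 1%N) -> m.-primitive_root z ->
    Q * \prod_(i <- L) (1 - 'X^i) = \prod_(i <- 1%N :: iota 1 n.-1) (1 - 'X^i) ->
  Q.[z] = (m ^ k * k`!)%:R.
Proof.
move=> m_gt1 f12 nE pL zm; have [A [EA <-]] := prod_1_sub_Xn_iota k m_gt1 zm.
have z1 : 1 - z != 0.
  rewrite subr_eq0 eq_sym -[z]expr1 -(prim_order_dvd zm) dvdn1.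
  by rewrite gtn_eqF.
have nzm : (1 - 'X^m) ^+ k != 0 :> {poly F}.
  rewrite expf_neq0 // -oppr_eq0 opprB -size_poly_eq0 size_XnsubC //; lia.
rewrite (perm_big _ pL) /= big_cat /= !big_nseq !iter_mulr_1 big_cons expr1.
have -> : n.-1 = (m * k + f.-1)%N by lia.
rewrite iotaD big_cat /= EA => E.
have {}E : Q * (1 - 'X) ^+ f = (1 - 'X) * (A * \prod_(i <- iota (1 + m * k) f.-1) (1 - 'X^i)).
  by apply: (mulfI nzm); rewrite mulrCA E [RHS]mulrCA -(mulrA _ A).
have [f1|f2] : f = 1%N \/ f = 2 by lia.
  move: E; rewrite f1 /= big_nil mulr1 expr1 mulrC => /(congr1 (horner^~ z)).
  by rewrite /= !hornerM hornerD hornerN hornerX hornerC => /(mulfI z1).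
move: E; rewrite f2 /= big_seq1 => /(congr1 (horner^~ z)).
rewrite /= expr2 !hornerM !hornerD !hornerN hornerXn hornerX hornerC.
rewrite add1n exprS exprM (prim_expr_order zm) expr1n mulr1 mulrCA.
by move/(mulfI z1)/(mulIf z1).
Qed.

End Quotient.

(** * Hilbert series *)

Section Dimension.
Variables (F : fieldType) (n N d : nat) (H : {group 'S_n.+1}).
Hypothesis dN : (d <= N)%N.
Local Notation forms := (dhomog n.+1 F d).
Local Notation expo := {ffun 'I_n.+1 -> 'I_N.+1}.
Local Notation orbs := (orbit (@expo_action n.+1 N) H @: expos n.+1 N d).

Definition orb_repr (B : {set expo}) : expo := odflt [ffun=> ord0] [pick a in B].

Definition orbit_coefs (p : forms) : 'rV[F]_#|orbs| :=
  \row_j (mpoly_of_dhomog p)@_(mon (orb_repr (enum_val j))).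

Fact orbit_coefs_linear : linear orbit_coefs.
Proof. by move=> c p q; apply/rowP=> j; rewrite !mxE linearP. Qed.

HB.instance Definition _ :=
  GRing.isLinear.Build F forms 'rV[F]_#|orbs| *:%R orbit_coefs orbit_coefs_linear.

Definition orbit_sum (B : {set expo}) : {mpoly F[n.+1]} := \sum_(a in B) 'X_[mon a].

Lemma orbsP B : B \in orbs -> exists2 a, a \in expos n.+1 N d & B = orbit (@expo_action n.+1 N) H a.
Proof. by case/imsetP=> a; exists a. Qed.

Lemma orb_pick B : B \in orbs -> orb_repr B \in B.
Proof.
rewrite /orb_repr; case/orbsP=> a _ ->; case: pickP => // /(_ a).
by rewrite orbit_refl.
Qed.

Lemma orb_expos B a : B \in orbs -> a \in B -> a \in expos n.+1 N d.
Proof. by case/orbsP=> b b_d -> /orbitP[h _ <-] /=; rewrite expos_act. Qed.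

Lemma orb_eq B a : B \in orbs -> a \in B -> B = orbit (@expo_action n.+1 N) H a.
Proof. by case/orbsP=> b _ -> ab; apply/esym/orbit_eqP. Qed.

Lemma orbit_sum_homog B : B \in orbs -> orbit_sum B \is d.-homog.
Proof.
move=> oB; apply: rpred_sum => a aB; rewrite dhomogX /= mdeg_mon.
by have := orb_expos oB aB; rewrite inE.
Qed.

Lemma mcoeff_orbit_sum B a : (orbit_sum B)@_(mon a) = (a \in B)%:R.
Proof.
rewrite raddf_sum /=; under eq_bigr do rewrite mcoeffX (inj_eq (@mon_inj _ _)).
have [aB|aB] := boolP (a \in B).
  by rewrite (bigD1 a) //= eqxx big1 ?addr0 // => b /andP[_ /negbTE->].
by rewrite big1 // => b bB; case: eqP bB aB => // -> ->.
Qed.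

Lemma msym_orbit_sum B h : h \in H -> B \in orbs -> msym h (orbit_sum B) = orbit_sum B.
Proof.
move=> Hh oB; rewrite raddf_sum /=.
rewrite [RHS](reindex_inj (act_inj (@expo_action n.+1 N) h)) /=.
apply: eq_big => [a|a _]; last by rewrite msymX mon_act.
have /orbsP[b _ ->] := oB.
by rewrite -[expo_act a h]/((@expo_action n.+1 N) a h) orbit_actr.
Qed.

(** An invariant form has constant coefficients along each orbit of monomials, so one coefficient
    per orbit determines it; orbit sums realize all choices. *)
Lemma dim_invariant_forms : \dim (invariant_forms F d H) = #|orbs|.
Proof.
set V := invariant_forms F d H; pose f := linfun orbit_coefs.
have kerV : (V :&: lker f)%VS = 0%VS.
  apply/eqP; rewrite -subv0; apply/subvP => p; rewrite memv_cap => /andP[pV].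
  rewrite memv_ker lfunE /= => /eqP p0; rewrite memv0; apply/eqP/val_inj/mpolyP => m /=.
  rewrite mcoeff0; have [md|md] := eqVneq (mdeg m) d; last first.
    exact: dhomog_nemf_coeff (dhomog_is_dhomog p) md.
  have [a a_d ->] := monP dN md.
  have oB : orbit (@expo_action n.+1 N) H a \in orbs by apply: imset_f.
  have := orb_pick oB; case/orbitP=> h Hh hE.
  have /rowP/(_ (enum_rank_in oB (orbit (@expo_action n.+1 N) H a))) := p0.
  rewrite !mxE enum_rankK_in // -hE /= mon_act -mcoeff_sym.
  by have /invariant_formsP/(_ _ (groupVr Hh)) -> := pV.
rewrite -(limg_dim_eq kerV).
have -> : (f @: V)%VS = fullv.
  apply/eqP; rewrite eqEsubv subvf; apply/subvP => v _; apply/memv_imgP.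
  have homP : \sum_j v 0 j *: orbit_sum (enum_val j) \is d.-homog.
    apply: rpred_sum => j _; apply: rpredZ; apply: orbit_sum_homog; exact: enum_valP.
  exists (DHomog homP).
    apply/invariant_formsP => h Hh /=; rewrite raddf_sum; apply: eq_bigr => j _ /=.
    by rewrite msymZ msym_orbit_sum //; apply: enum_valP.
  apply/rowP => j; rewrite lfunE /= !mxE raddf_sum (bigD1 j) //=.
  have oj := enum_valP j; have ij := orb_pick oj.
  rewrite mcoeffZ mcoeff_orbit_sum ij mulr1 big1 ?addr0 // => k kj.
  rewrite mcoeffZ mcoeff_orbit_sum; case ik: (_ \in _); rewrite ?mulr0 //.
  case/eqP: kj; apply: enum_val_inj.
  exact: etrans (orb_eq (enum_valP k) ik) (esym (orb_eq oj ij)).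
by rewrite dimvf /dim /= mul1n.
Qed.

End Dimension.

(* Truncation of 1/(1 - X^l), exact modulo X^(N+1). *)
Definition geom (F : nzRingType) (N l : nat) : {poly F} := \sum_(j < N.+1) 'X^(l * j).

(** Expansion of the product by distributivity. Functions in [pffun_on] take the value [ord0]
    outside [P], so each choice of exponents is counted once. *)
Lemma coef_prod_geom (F : comNzRingType) (I : finType) (P : pred I) (w : I -> nat) N d :
  (\prod_(i | P i) geom F N (w i))`_d =
  #|[set f in pffun_on ord0 P predT | \sum_(i | P i) w i * (f i : 'I_N.+1) == d]%N|%:R.
Proof.
rewrite /geom (big_distr_big ord0) /= coef_sum.
rewrite -sum1_card natr_sum [RHS](eq_bigl _ _ (fun f => in_set _ f)).
rewrite [RHS]big_mkcondr; apply: eq_bigr => f _ /=.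
have -> : \prod_(i | P i) 'X^(w i * f i) = 'X^(\sum_(i | P i) w i * f i) :> {poly F}.
  by rewrite (big_morph _ (exprD 'X) (expr0 'X)).
by rewrite coefXn eq_sym; case: eqP.
Qed.

(** A vector fixed by [h] is constant on the cycles of [h], and a cycle [B] contributes [#|B|] times
    its value to the degree. *)
Lemma card_fix_expos (F : comNzRingType) n N d (h : 'S_n) :
  #|('Fix_(expos n N d | expo_action n N)[h])%g|%:R =
  (\prod_(B in porbits h) geom F N #|B|)`_d.
Proof.
rewrite (@coef_prod_geom F _ (mem (porbits h)) (fun B : {set 'I_n} => #|B|)).
congr _%:R; pose A (f : {ffun {set 'I_n} -> 'I_N.+1}) : {ffun 'I_n -> 'I_N.+1} :=
  [ffun i => f (porbit h i)].
set S := [set _ in _ | _]; rewrite -(@card_in_imset _ _ A (mem S)); last first.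
  move=> f g; rewrite !inE => /andP[/pffun_onP[sf _] _] /andP[/pffun_onP[sg _] _] E.
  apply/ffunP=> B; have [/imsetP[i _ ->]|nB] := boolP (B \in porbits h).
    by have /ffunP/(_ i) := E; rewrite !ffunE.
  rewrite (supportP sf) ?(supportP sg) //.
apply: eq_card => a; apply/setIP/imsetP => [[a_d /afix1P/ffunP ha] | [f fS ->]].
  have {}ha i : a (h i) = a i by rewrite -{1}ha ffunE permK.
  have haX i j : a ((h ^+ j)%g i) = a i.
    by elim: j => [|j IHj]; rewrite ?perm1 // expgSr permM ha.
  pose f := [ffun B : {set 'I_n} => if B \in porbits h then
    odflt ord0 (omap a [pick i in B]) else ord0].
  have fE i : f (porbit h i) = a i.
    rewrite ffunE imset_f //; case: pickP => [j|/(_ i)] /=; last by rewrite porbit_id.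
    by case/porbitP=> k ->; apply: haX.
  exists f; last by apply/ffunP=> i; rewrite ffunE fE.
  rewrite !inE; apply/andP; split.
    apply/pffun_onP; split=> //; apply/supportP => B /negbTE nB.
    by rewrite ffunE nB.
  rewrite -(sum_porbits h (fun B => f B)); move: a_d; rewrite inE.
  by under eq_bigr do rewrite -fE.
have {fS} : (\sum_(B in porbits h) #|B| * f B == d)%N by move: fS; rewrite !inE => /andP[].
rewrite -(sum_porbits h (fun B => f B)) => sf; split.
  by rewrite inE; under eq_bigr do rewrite ffunE.
by apply/afix1P/ffunP=> i; rewrite !ffunE -(porbit_perm h 1) expg1 permKV.
Qed.

Section Sorted.
Variables n N d : nat.
Hypothesis dN : (d <= N)%N.
Local Notation expo := {ffun 'I_n -> 'I_N.+1}.
Implicit Types a b : expo.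

(* Orbits of S_n on exponent vectors are partitions of [d] into at most [n]
   parts; [b i] is the multiplicity of i+1 in the conjugate partition, which
   gives the series of prod_i 1/(1 - X^i). *)
Definition tail_sum b (j : nat) := (\sum_(i < n | j <= i) b i)%N.

Definition of_steps b : expo := [ffun j : 'I_n => inord (tail_sum b j)].

Definition steps := [set b : expo | \sum_(i < n) i.+1 * b i == d]%N.

Lemma tail_sumS b (j : 'I_n) : tail_sum b j = (b j + tail_sum b j.+1)%N.
Proof.
rewrite /tail_sum (bigD1 j) //=; congr addn; apply: eq_bigl => i.
by rewrite ltn_neqAle andbC eq_sym.
Qed.

Lemma sum_tail_sum b : (\sum_(j < n) tail_sum b j = \sum_(i < n) i.+1 * b i)%N.
Proof.
rewrite /tail_sum (exchange_big_dep predT) //=; apply: eq_bigr => i _.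
rewrite sum_nat_const; congr muln; rewrite -[RHS]card_ord -sum1_card.
rewrite (eq_bigl (fun j : 'I_n => j < i.+1)%N) //.
by rewrite (big_ord_narrow (ltn_ord i)) sum1_card.
Qed.

Lemma tail_sum_le b j : b \in steps -> (tail_sum b j <= d)%N.
Proof.
rewrite inE => /eqP <-; rewrite /tail_sum big_mkcond /=; apply: leq_sum => i _.
by case: ifP => // _; rewrite mulSn leq_addr.
Qed.

Lemma of_stepsE b (j : 'I_n) : b \in steps -> of_steps b j = tail_sum b j :> nat.
Proof. by move=> b_d; rewrite ffunE inordK // ltnS (leq_trans (tail_sum_le _ b_d)). Qed.

Lemma of_steps_expos b : b \in steps -> of_steps b \in expos n N d.
Proof.
move=> b_d; rewrite inE; under eq_bigr do rewrite of_stepsE //.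
by rewrite sum_tail_sum; move: b_d; rewrite inE.
Qed.

Lemma of_steps_inj : {in steps &, injective of_steps}.
Proof.
move=> b b' b_d b'_d E; have {}E j : tail_sum b j = tail_sum b' j.
  have [jn|nj] := ltnP j n.
    by rewrite -(of_stepsE (Ordinal jn) b_d) E of_stepsE.
  by rewrite /tail_sum !big_pred0 // => i; rewrite leqNgt (leq_trans (ltn_ord i) nj).
apply/ffunP=> j; apply/val_inj/eqP => /=.
by rewrite -(eqn_add2r (tail_sum b j.+1)) -tail_sumS (E j.+1) -tail_sumS E.
Qed.

Definition nonincreasing a := sorted geq [seq (a i : nat) | i <- enum 'I_n].

Lemma nonincreasingP a :
  reflect (forall i j : 'I_n, i <= j -> a j <= a i)%N (nonincreasing a).
Proof.
have geq_trans : transitive geq by move=> x y z /= yx zx; apply: leq_trans zx yx.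
have nthE (k : 'I_n) : nth 0%N [seq (a i : nat) | i <- enum 'I_n] k = a k.
  by rewrite (nth_map k) ?size_enum_ord // nth_ord_enum.
apply: (iffP idP) => [Sa i j ij|Ha].
  have := @sorted_leq_nth _ _ geq_trans leqnn 0%N _ Sa i j.
  rewrite !inE size_map size_enum_ord => /(_ (ltn_ord i) (ltn_ord j) ij).
  by rewrite /= !nthE.
apply/(sortedP 0%N) => i; rewrite size_map size_enum_ord => i_n.
rewrite -[i.+1]/(val (Ordinal i_n)) -[i in nth _ _ i]/(val (Ordinal (ltnW i_n))) !nthE.
exact: Ha.
Qed.

Lemma of_steps_nonincreasing b : b \in steps -> nonincreasing (of_steps b).
Proof.
move=> b_d; apply/nonincreasingP => i j ij; rewrite !of_stepsE //.
rewrite /tail_sum big_mkcond [leqRHS]big_mkcond /=; apply: leq_sum => k _.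
by case: (leqP j k) => // jk; rewrite (leq_trans ij jk).
Qed.

Lemma of_steps_onto a : a \in expos n N d -> nonincreasing a ->
  exists2 b, b \in steps & a = of_steps b.
Proof.
move=> a_d /nonincreasingP Ha.
(* Extending [a] by 0 beyond its last index makes the last difference equal to the last entry. *)
pose al (j : nat) := if insub j is Some i then (a i : nat) else 0%N.
have alE (i : 'I_n) : al i = a i by rewrite /al valK.
have al_n j : (n <= j)%N -> al j = 0%N.
  by move=> nj; rewrite /al insubF // ltnNge nj.
have al_le (i : 'I_n) : (al i.+1 <= al i)%N.
  have [i_n|/al_n-> //] := ltnP i.+1 n.
  by rewrite -[i.+1]/(val (Ordinal i_n)) !alE Ha /=.
pose b : expo := [ffun i : 'I_n => inord (al i - al i.+1)%N].
have bE i : b i = (al i - al i.+1)%N :> nat.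
  by rewrite ffunE inordK // alE (leq_ltn_trans (leq_subr _ _)).
(* Downward induction on [j]: the tail sums of the differences telescope. *)
have tsE k j : (n - j = k)%N -> tail_sum b j = al j.
  elim: k j => [|k IHk] j nj.
    have {}nj : (n <= j)%N by lia.
    by rewrite al_n // /tail_sum big_pred0 // => i; rewrite leqNgt (leq_trans (ltn_ord i) nj).
  have jn : (j < n)%N by lia.
  rewrite (tail_sumS b (Ordinal jn)) bE /= IHk ?subnK //; first exact: (al_le (Ordinal jn)).
  by lia.
have b_d : b \in steps.
  move: a_d; rewrite !inE -sum_tail_sum => /eqP <-; apply/eqP/eq_bigr => i _.
  by rewrite (tsE _ _ erefl) alE.
by exists b => //; apply/ffunP=> i; apply/val_inj; rewrite /= of_stepsE // (tsE _ _ erefl) alE.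
Qed.

Lemma nonincreasing_orbit a a' s : nonincreasing a -> nonincreasing a' ->
  a' = expo_act a s -> a = a'.
Proof.
move=> Sa Sa' E.
have geq_trans : transitive geq by move=> x y z /= yx zx; apply: leq_trans zx yx.
have geq_anti : antisymmetric geq by move=> x y /= xy; apply/eqP; rewrite eqn_leq andbC.
have pa : perm_eq [seq (a i : nat) | i <- enum 'I_n] [seq (a' i : nat) | i <- enum 'I_n].
  rewrite (_ : [seq (a' i : nat) | i <- enum 'I_n] =
               [seq (a i : nat) | i <- [seq (s^-1)%g i | i <- enum 'I_n]]); last first.
    by rewrite -[RHS]map_comp; apply: eq_map => i /=; rewrite E ffunE.
  apply/perm_map/uniq_perm; rewrite ?enum_uniq ?(map_inj_uniq (@perm_inj _ _)) ?enum_uniq //.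
  move=> i; rewrite mem_enum inE; apply/esym/mapP.
  by exists (s i); rewrite ?mem_enum // permK.
have := sorted_eq geq_trans geq_anti Sa Sa' pa.
by move/eq_in_map => Eq; apply/ffunP=> i; apply/val_inj/Eq; rewrite mem_enum.
Qed.

Lemma nonincreasing_exists a : exists s, nonincreasing (expo_act a s).
Proof.
pose t := [tuple (a i : nat) | i < n].
have szt : size (sort geq t) == n by rewrite size_sort size_tuple.
have /tuple_permP[p pE] : perm_eq (Tuple szt) t by rewrite perm_sort.
exists (p^-1)%g; rewrite /nonincreasing.
have -> : [seq (expo_act a p^-1 i : nat) | i <- enum 'I_n] = sort geq t.
  rewrite [RHS]pE; apply: eq_map => i; rewrite ffunE invgK.
  by rewrite tnth_mktuple.
by apply: sort_sorted => x y /=; apply: leq_total.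
Qed.

(** Sorting shows that each orbit contains exactly one nonincreasing vector, and [of_steps]
    parametrizes these. *)
Lemma card_orbits_full :
  #|orbit (expo_action n N) [set: 'S_n]%G @: expos n N d| = #|steps|.
Proof.
pose orb b := orbit (expo_action n N) [set: 'S_n]%G (of_steps b).
rewrite -(@card_in_imset _ _ orb (mem steps)).
  apply: eq_card => B; apply/imsetP/imsetP => [[a a_d ->] | [b b_d ->]]; last first.
    by exists (of_steps b) => //; apply: of_steps_expos.
  have [s Ss] := nonincreasing_exists a.
  have [|b b_d bE] := of_steps_onto _ Ss; first by rewrite expos_act.
  exists b => //; rewrite /orb -bE; apply/esym.
  by rewrite -[expo_act a s]/(expo_action n N a s) orbit_act ?inE.
move=> b b' b_d b'_d; rewrite /orb => E.
have : of_steps b' \in orbit (expo_action n N) [set: 'S_n]%G (of_steps b).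
  by rewrite E orbit_refl.
case/orbitP=> s _ sE; apply: of_steps_inj => //.
exact: nonincreasing_orbit (of_steps_nonincreasing b_d) (of_steps_nonincreasing b'_d) (esym sE).
Qed.

End Sorted.

Lemma card_orbits_full_coef (F : comNzRingType) n N d : (d <= N)%N ->
  #|orbit (expo_action n N) [set: 'S_n]%G @: expos n N d|%:R =
  (\prod_(i <- iota 1 n) geom F N i)`_d.
Proof.
move=> dN; rewrite card_orbits_full //.
have -> : \prod_(i <- iota 1 n) geom F N i = \prod_(i < n) geom F N i.+1.
  rewrite -[iota 1 n]/(iota (1 + 0) n) iotaDl big_map.
  by rewrite -(big_mkord xpredT (fun i => geom F N i.+1)) /index_iota subn0.
rewrite (@coef_prod_geom F _ predT (fun i : 'I_n => i.+1)); congr _%:R.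
apply: eq_card => b; rewrite [in RHS]inE inE.
have -> // : b \in pffun_on ord0 predT predT.
by apply/pffun_onP; split=> //; apply/subsetP.
Qed.

(** * Power series truncated modulo X^(N+1) *)

Section Series.
Variable F : fieldType.
Implicit Types (p q : {poly F}) (L : seq nat).

Lemma dvdp_Xn_coef M p : (forall i, (i < M)%N -> p`_i = 0) -> 'X^M %| p.
Proof.
move=> p0; rewrite -(poly_take_drop M p).
have -> : take_poly M p = 0.
  by apply/polyP=> i; rewrite coef_take_poly coef0; case: ifP => // /p0.
by rewrite add0r dvdp_mull.
Qed.

Lemma coef_dvdp_Xn M p i : 'X^M %| p -> (i < M)%N -> p`_i = 0.
Proof. by case/dvdpP=> q -> iM; rewrite coefMXn iM. Qed.

Lemma prod_geom_inv N L : all (leq 1) L ->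
  'X^(N.+1) %| \prod_(l <- L) (1 - 'X^l) * \prod_(l <- L) geom F N l - 1.
Proof.
elim: L => [|l L IHL] /=; first by rewrite !big_nil mulr1 subrr dvdp0.
case/andP=> l_gt0 /IHL{}IHL; rewrite !big_cons mulrACA.
have -> : (1 - 'X^l) * geom F N l = 1 - 'X^(l * N.+1).
  rewrite exprM -[RHS]opprB subrX1 -mulNr opprB; congr (_ * _).
  by apply: eq_bigr => i _; rewrite exprM.
set u := _ * _ in IHL *.
rewrite mulrBl mul1r addrAC; apply: dvdp_sub => //.
by rewrite dvdp_mulr // dvdp_exp2l // leq_pmull.
Qed.

Lemma qintE n : (1 - 'X) * qint F n = 1 - 'X^n.
Proof.
rewrite -[RHS]opprB subrX1 -mulNr opprB; congr (_ * _).
by rewrite /qint poly_def; apply: eq_bigr => i _; rewrite scale1r.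
Qed.

End Series.

(** * Molien's formula, existence and uniqueness of Y(q) *)

Section Hilbert.
Variables (F : fieldType) (n : nat).
Hypothesis n_gt0 : (0 < n)%N.
Implicit Types (H : {group 'S_n}) (Y : {poly F}).

Lemma hilb_orbits H N d : (d <= N)%N ->
  hilb F H d = #|orbit (expo_action n N) H @: expos n N d|.
Proof. by case: n n_gt0 H => // n' _ H dN; apply: dim_invariant_forms. Qed.

Lemma hilb_full N d : (d <= N)%N ->
  (hilb F [set: 'S_n]%G d)%:R = (\prod_(i <- iota 1 n) geom F N i)`_d.
Proof. by move=> dN; rewrite (hilb_orbits _ dN) card_orbits_full_coef. Qed.

(** The Hilbert function counts orbits on exponent vectors of degree [d]; by Frobenius-Cauchy this
    is an average of fixed-point counts. *)
Lemma hilb_Molien H N d : (d <= N)%N ->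
  (hilb F H d)%:R * #|H|%:R =
  (\sum_(h in H) \prod_(i <- cycle_sizes h) geom F N i)`_d.
Proof.
move=> dN; rewrite (hilb_orbits _ dN) -natrM.
rewrite -(Frobenius_Cauchy (acts_expos N H d)) natr_sum coef_sum.
apply: eq_bigr => h _; rewrite card_fix_expos big_map big_enum.
by [].
Qed.

Lemma coef_Yq Y N d : (d <= N)%N ->
  \sum_(i < d.+1) (Y * qint F n)`_i * (hilb F [set: 'S_n]%G (d - i))%:R =
  (Y * qint F n * \prod_(i <- iota 1 n) geom F N i)`_d.
Proof.
move=> dN; rewrite coefM; apply: eq_bigr => i _; rewrite (@hilb_full N) //.
exact: leq_trans (leq_subr _ _) dN.
Qed.

Variables (H : {group 'S_n}) (Q : 'S_n -> {poly F}).
Hypothesis H_neq0 : #|H|%:R != 0 :> F.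
Hypothesis QP : forall h, h \in H ->
  Q h * \prod_(i <- cycle_sizes h) (1 - 'X^i) =
  \prod_(i <- 1%N :: iota 1 n.-1) (1 - 'X^i).

Definition avgQ : {poly F} := #|H|%:R^-1 *: \sum_(h in H) Q h.

(** Multiplication by [n]_q trades the repeated factor 1 - X for the missing 1 - X^n. *)
Lemma Q_qint h : h \in H ->
  Q h * qint F n * \prod_(i <- cycle_sizes h) (1 - 'X^i) =
  \prod_(i <- iota 1 n) (1 - 'X^i).
Proof.
move=> Hh; rewrite mulrAC QP // big_cons expr1 mulrAC qintE.
rewrite -[in RHS](prednK n_gt0) -[n.-1.+1]addn1 iotaD big_cat big_seq1 /= add1n.
by rewrite (prednK n_gt0) mulrC.
Qed.

Lemma avgQ_is_Yq : is_Yq H avgQ.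
Proof.
move=> d; rewrite (coef_Yq _ (leqnn d)).
apply: (mulIf H_neq0); rewrite (hilb_Molien H (leqnn d)).
rewrite mulrC -coefZ; apply/eqP; rewrite -subr_eq0 -coefB; apply/eqP.
apply: (@coef_dvdp_Xn _ d.+1) => //.
rewrite /avgQ -!scalerAl scalerA divff // scale1r !mulr_suml -sumrB.
apply: (big_ind (fun p : {poly F} => 'X^(d.+1) %| p)) => [||h Hh]; first exact: dvdp0.
  by move=> p q; apply: dvdp_add.
set P := \prod_(_ <- _) _; set G := \prod_(_ <- _) _.
have := prod_geom_inv F d (cycle_sizes_gt0 h); rewrite -/G.
have : all (leq 1) (iota 1 n) by apply/allP=> i; rewrite mem_iota => /andP[].
move/(prod_geom_inv F d); rewrite -/P -(Q_qint Hh).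
set L := \prod_(_ <- _) _; set W := Q h * _.
move=> dP dG.
(* Modulo X^(d+1), [P] inverts [W * L] and [G] inverts [L], so [W * P] and [G] agree. *)
have -> : W * P - G = (W * L * P - 1) * G - (L * G - 1) * (W * P) by ring.
by rewrite dvdp_sub ?dvdp_mulr.
Qed.

Lemma is_Yq_unique Y : is_Yq H Y -> Y = avgQ.
Proof.
move=> HY; apply/eqP; rewrite -subr_eq0; apply/eqP.
(* [N] is the size of [Z * qint F n], so divisibility of that polynomial by X^(N+1) forces it to
   vanish. *)
set Z := Y - avgQ; set N := size (Z * qint F n).
pose P : {poly F} := \prod_(i <- iota 1 n) geom F N i.
have dZ : 'X^(N.+1) %| Z * qint F n * P.
  apply: dvdp_Xn_coef => i iN; rewrite /Z !mulrBl coefB.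
  by rewrite -!coef_Yq // HY avgQ_is_Yq subrr.
have : all (leq 1) (iota 1 n) by apply/allP=> i; rewrite mem_iota => /andP[].
move/(prod_geom_inv F N); rewrite -/P; set D := \prod_(_ <- _) _ => dD.
have dZq : 'X^(N.+1) %| Z * qint F n.
  have -> : Z * qint F n = (Z * qint F n * P) * D - (D * P - 1) * (Z * qint F n) by ring.
  by apply: dvdp_sub; apply: dvdp_mulr.
have qn0 : qint F n != 0.
  apply/eqP => q0; have := qintE F n; rewrite q0 mulr0 => /esym/eqP.
  by rewrite -oppr_eq0 opprB -size_poly_eq0 size_XnsubC.
have [/eqP|nz] := eqVneq (Z * qint F n) 0.
  by rewrite mulf_eq0 (negbTE qn0) orbF => /eqP.
by have := dvdp_leq nz dZq; rewrite size_polyXn -/N ltnNge leqnSn.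
Qed.

End Hilbert.

(** * Comparison of the value of Y at zeta with the number of fixed double cosets *)

Theorem theorem4p7 (R : realType) (n : nat) (n_ge3 : (3 <= n)%N)
    (tau : 'S_n) (H : {group 'S_n})
    (adm : C_admissible tau H)
    (avoid42 : avoids H (4%N :: nseq ((n - 4) %/ 2) 2%N))
    (zeta : R[i]) (zeta_prim : #[tau]%g.-primitive_root zeta) :
  (exists Yq : {poly R[i]}, is_Yq H Yq) /\
  (forall Yq : {poly R[i]}, is_Yq H Yq -> Yq.[zeta] = #|FixY H tau|%:R).
Proof.
have n_gt0 : (0 < n)%N by apply: leq_trans n_ge3.
have [nCt [m [m_gt1 tauT noL no2 _]]] := adm.
set k := (n.-1 %/ m)%N in no2 tauT *.
have [f f12 tT] : exists2 f, (0 < f <= 2)%N &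
    perm_eq (cycle_sizes tau) (nseq k m ++ nseq f 1%N).
  case: tauT => tT; [by exists 1%N | exists 2 => //].
  (* With two fixed points, n - 2 is a multiple of [m], and n - 1 has the same quotient by [m]
     because m > 1. *)
  suff -> : k = (n.-2 %/ m)%N by [].
  have := sumn_cycle_sizes tau; rewrite card_ord (perm_sumn tT).
  rewrite sumn_cat sumn_nseq /=; set k' := (n.-2 %/ m)%N => nE.
  have -> : k = ((k' * m + 1) %/ m)%N by rewrite /k -nE mulnC; congr (_ %/ _)%N; lia.
  by rewrite divnMDl ?(ltnW m_gt1) // divn_small // addn0.
have nE : n = (m * k + f)%N by rewrite -(card_type_mk1 tT) card_ord.
(* Otherwise n = f <= 2, against [n_ge3]; a cycle of length [m] is what gives [tau] the order
   [m]. *)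
have k_gt0 : (0 < k)%N by rewrite lt0n; apply/eqP => k0; move: nE f12; rewrite k0; lia.
have otau : #[tau]%g = m by rewrite (order_type_mk1 tT).
rewrite otau in zeta_prim.
have regH l h : (1 < l)%N -> (l %| n)%N -> h \in H ->
    ~~ perm_eq (cycle_sizes h) (nseq (n %/ l) l).
  by move=> l_gt1 ln; apply: noL.
have avH h : h \in H -> ~~ perm_eq (cycle_sizes h) (nseq k m ++ [:: 2]) by apply: no2.
have sum_h (h : 'S_n) : sumn (cycle_sizes h) = n by rewrite sumn_cycle_sizes card_ord.
have exQ h : exists Q : {poly R[i]}, h \in H ->
    Q * \prod_(i <- cycle_sizes h) (1 - 'X^i) =
      \prod_(i <- 1%N :: iota 1 n.-1) (1 - 'X^i) /\
    (count (dvdn m) (cycle_sizes h) != k -> Q.[zeta] = 0).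
  have [Hh|_] := boolP (h \in H); last by exists 0.
  have [Q [EQ rQ]] := quotient_exists R[i] (cycle_sizes_gt0 h) (sum_h h) n_gt0
     (fun l l_gt1 ln => regH l h l_gt1 ln Hh).
  by exists Q => _; split=> //; apply: rQ.
have [Q QP] := fin_all_exists exQ.
have QE h (Hh : h \in H) := proj1 (QP h Hh).
have Q_zeta h : h \in H ->
    (Q h).[zeta] = if perm_eq (cycle_sizes h) (nseq k m ++ nseq f 1%N)
                   then (m ^ k * k`!)%:R else 0.
  move=> Hh; case: ifP => [h_ds|/negP h_ds].
    exact: quotient_eval m_gt1 f12 nE h_ds zeta_prim (QE h Hh).
  (* If [k] cycle lengths were divisible by [m], avoidance of (m^k, 2) and (4, 2^((n-4)/2)) would
     force the type of [tau]. *)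
  apply: (proj2 (QP h Hh)); apply/eqP => ck; case: h_ds.
  apply: (perm_type_mk1 m_gt1 k_gt0 f12 (cycle_sizes_gt0 h) _ ck); first by rewrite sum_h.
    exact: avH.
  by rewrite -nE; apply: avoid42.
have H_neq0 : #|H|%:R != 0 :> R[i] by rewrite pnatr_eq0 -lt0n cardG_gt0.
split; first by exists (avgQ H Q); apply: avgQ_is_Yq.
move=> Yq /(is_Yq_unique n_gt0 H_neq0 QE)->.
rewrite /avgQ hornerZ horner_sum (eq_bigr _ Q_zeta) -big_mkcondr sumr_const.
have := card_FixY_type nCt m_gt1 f12 tT regH avH.
move/(congr1 (fun x => x%:R : R[i])); rewrite !natrM => E.
(* After multiplication by [#|H|], both sides are m^k k! times the number of elements of [H] of the
   type of [tau]. *)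
apply: (mulfI H_neq0); rewrite mulVKf // [RHS]mulrC E -!natrM -mulrnA mulnC.
by congr (_ * _)%:R; apply: eq_card => h; rewrite [RHS]inE.
Qed.
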